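(* Let $R$ be a $1$-dimensional Cohen-Macaulay local ring of type $2$ with a canonical ideal $\mathcal C$. Let $(a)$ be a minimal reduction of $\mathcal C$. Then $R$ is a $3$-AGL ring if and only if one of the following holds: (1) $\mathrm{cdeg}(R)=3$ and $\rho(R)=2$; (2) $\mathrm{cdeg}(R)=2$, $\rho(R)=3$, and $\lambda(\mathcal C^3/a\mathcal C^2)=1$.
   Context: Let $(R,\mathfrak m)$ be a $1$-dimensional Cohen-Macaulay local ring with a canonical ideal $\mathcal C$, that is, a (proper, $\mathfrak m$-primary) ideal of $R$ isomorphic to a canonical module of $R$. Write $\lambda$ for length. For an $\mathfrak m$-primary ideal $I$, the Hilbert coefficients $e_0(I),e_1(I)$ are the integers with $\lambda(R/I^{n+1})=e_0(I)(n+1)-e_1(I)$ for all $n\gg0$. The canonical degree of $R$ is $\mathrm{cdeg}(R)=e_0(\mathcal C)-\lambda(R/\mathcal C)$; if $(a)$ is a minimal reduction of $\mathcal C$, then $\mathrm{cdeg}(R)=\lambda(\mathcal C/(a))$. It is independent of the choice of $\mathcal C$. The canonical index $\rho(R)$ is the reduction number of the canonical ideal $\mathcal C$ (the least integer $n\ge 0$ with $\mathcal C^{n+1}=a\mathcal C^n$ for a minimal reduction $(a)$ of $\mathcal C$); it is an invariant of $R$. For a positive integer $n$, $R$ is called an $n$-almost Gorenstein local ring ($n$-AGL for short) if $s_0(S)=n$, where $S=S_{(a)}(\mathcal C)=\bigoplus_{j\ge1}\mathcal C^{j+1}/a^j\mathcal C$ is the Sally module of $\mathcal C$ relative to a minimal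 reduction $(a)$ and $s_0(S)=e_1(\mathcal C)-e_0(\mathcal C)+\lambda(R/\mathcal C)$ is its multiplicity (an invariant of $R$); equivalently, $e_1(\mathcal C)=e_0(\mathcal C)-\lambda(R/\mathcal C)+n=\mathrm{cdeg}(R)+n$. The type of $R$ is the Cohen-Macaulay type, i.e. the minimal number of generators of $\mathcal C$. *)

(* Defs.v *)
From HB Require Import structures.
From mathcomp Require Import all_boot all_order all_algebra.
From mathcomp Require Import boolp classical_sets.

Set Implicit Arguments.
Unset Strict Implicit.
Unset Printing Implicit Defensive.

Import GRing.Theory.
Local Open Scope classical_set_scope.
Local Open Scope ring_scope.

(** ** Submodules and length *)

Section Modules.
Variables (R : comNzRingType) (V : lmodType R).

Definition submodule (N : set V) : Prop := submod_closed (mem N).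

Definition span (S : set V) : set V := smallest submodule S.

Definition finitely_generated (N : set V) : Prop :=
  exists s : seq V, N = span [set` s].

Definition min_num_generators (N : set V) (r : nat) : Prop :=
  (exists2 s : seq V, size s = r & N = span [set` s]) /\
  (forall s : seq V, N = span [set` s] -> (r <= size s)%N).

(* F is a strict chain of submodules N = F 0 < F 1 < ... < F l = M. *)
Definition submodule_chain (M N : set V) (l : nat) (F : nat -> set V) : Prop :=
  [/\ F 0%N = N, F l = M,
      forall i, (i <= l)%N -> submodule (F i) &
      forall i, (i < l)%N -> F i `<` F i.+1].

(* The quotient module M / N, for submodules N of M, has finite length l;
   submodules of M / N are those of V lying between N and M. *)
Definition length_quot (M N : set V) (l : nat) : Prop :=
  (exists F, submodule_chain M N l F) /\
  (forall l' F, submodule_chain M N l' F -> (l' <= l)%N).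

End Modules.

(** ** Ideals of a commutative ring *)

Section Ideals.
Variable R : comNzRingType.
Implicit Types (I J m : set R) (x y : R) (xs : seq R).

Definition ideal I : Prop := @submodule R R^o I.

Definition ideal_span (S : set R) : set R := @span R R^o S.

Definition principal x : set R := ideal_span [set x].

Definition ideal_mul I J : set R :=
  ideal_span [set z | exists x y, [/\ I x, J y & z = x * y]].

Definition ideal_pow I n : set R := iter n (ideal_mul I) [set: R].

Definition proper_idl I : Prop := idealr_closed (mem I).

Definition prime_ideal (P : set R) : Prop :=
  proper_idl P /\ prime_idealr_closed (mem P).

Definition maximal_ideal m : Prop :=
  proper_idl m /\ (forall I, proper_idl I -> m `<=` I -> I = m).

Definition radical I : set R := [set x | exists n, I (x ^+ n)].

Definition primary_ideal I : Prop :=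
  proper_idl I /\ (forall x y, I (x * y) -> I x \/ radical I y).

(* m-primary ideals *)
Definition primary_to m I : Prop := primary_ideal I /\ radical I = m.

Definition noetherian : Prop :=
  forall I, ideal I -> @finitely_generated R R^o I.

Definition noetherian_local m : Prop :=
  [/\ noetherian, maximal_ideal m & forall m', maximal_ideal m' -> m' = m].

Definition prime_chain (d : nat) (P : nat -> set R) : Prop :=
  (forall i, (i <= d)%N -> prime_ideal (P i)) /\
  (forall i, (i < d)%N -> P i `<` P i.+1).

Definition krull_dim (d : nat) : Prop :=
  (exists P, prime_chain d P) /\
  (forall d' P, prime_chain d' P -> (d' <= d)%N).

(* xs is an R-regular sequence contained in m; when m is proper the condition
   R <> (xs) R is automatic. *)
Definition regular_sequence m xs : Prop :=
  [set` xs] `<=` m /\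
  (forall i, (i < size xs)%N -> forall y,
     ideal_span [set` take i xs] (xs`_i * y) ->
     ideal_span [set` take i xs] y).

Definition depth m (d : nat) : Prop :=
  (exists2 xs, regular_sequence m xs & size xs = d) /\
  (forall xs, regular_sequence m xs -> (size xs <= d)%N).

(* (R, m) is a d-dimensional Cohen-Macaulay local ring *)
Definition cohen_macaulay_local m (d : nat) : Prop :=
  [/\ noetherian_local m, krull_dim d & depth m d].

Definition reduction J I : Prop :=
  [/\ ideal J, J `<=` I &
      exists n, ideal_pow I n.+1 = ideal_mul J (ideal_pow I n)].

Definition minimal_reduction J I : Prop :=
  reduction J I /\ (forall J', reduction J' I -> J' `<=` J -> J' = J).

End Ideals.

(** ** Canonical modules *)

Section Canonical.
Variable R : comNzRingType.

(* Ranks of the terms of a free resolution whose degree-0 term is R. *)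
Definition res_rank (n : nat -> nat) (i : nat) : nat :=
  if i is j.+1 then n j else 1%N.

Section Ext.
Variables (n : nat -> nat)
  (d : forall i, 'M[R]_(res_rank n i.+1, res_rank n i)).

(* Vectors are rows and d i acts on the right:
     ... -> R^(n 1) -> R^(n 0) -> R -> R / I -> 0   is exact. *)
Definition free_resolution (I : set R) : Prop :=
  (forall x : R, I x <-> exists w : 'rV[R]_(n 0%N), x%:M = w *m d 0%N) /\
  (forall i (v : 'rV[R]_(res_rank n i.+1)),
     v *m d i = 0 <-> exists w, v = w *m d i.+1).

Variable K : lmodType R.

(* Hom(R^p, K) is identified with K^p by evaluation at the standard basis;
   this is the map Hom(D, K) for D : R^q -> R^p. *)
Definition hom_dual p q (D : 'M[R]_(q, p)) (f : {ffun 'I_p -> K}) :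
    {ffun 'I_q -> K} := [ffun j => \sum_k D j k *: f k].

Definition cocycles i : set {ffun 'I_(res_rank n i) -> K} :=
  [set f | hom_dual (d i) f = 0].

Definition coboundaries i : set {ffun 'I_(res_rank n i) -> K} :=
  match i with
  | 0%N => [set 0]
  | j.+1 => range (hom_dual (d j))
  end.

(* When d is a free resolution of R / I: Ext^i_R(R / I, K) has length l. *)
Definition ext_length (i l : nat) : Prop :=
  length_quot (@cocycles i) (@coboundaries i) l.

End Ext.

(* K is finitely generated and, for k = R / m, Ext^i_R(k, K) is k for
   i = dim R and 0 otherwise; over a Cohen-Macaulay local ring this says that
   K is maximal Cohen-Macaulay of type 1 and of finite injective dimension. *)
Definition canonical_module (m : set R) (K : lmodType R) : Prop :=
  finitely_generated [set: K] /\
  exists dimR, krull_dim R dimR /\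
  exists n (d : forall i, 'M[R]_(res_rank n i.+1, res_rank n i)),
    free_resolution d m /\
    forall i, ext_length d K i (if i == dimR then 1%N else 0%N).

Definition canonical_ideal (m C : set R) : Prop :=
  primary_to m C /\
  exists (K : lmodType R) (f : {linear K -> R^o}),
    [/\ canonical_module m K, injective f & range f = C].

End Canonical.

(** ** Invariants attached to a canonical ideal C and a minimal reduction (a) *)

Section Invariants.
Variable R : comNzRingType.
Implicit Types (I C : set R) (a : R).

Definition ideal_length (I J : set R) (l : nat) : Prop :=
  @length_quot R R^o I J l.

Definition hilbert_coefficients I (e0 e1 : int) : Prop :=
  exists N : nat, forall n, (N <= n)%N ->
    exists2 l, ideal_length [set: R] (ideal_pow I n.+1) l &
               l%:Z = e0 * n.+1%:Z - e1.

(* The type of R, as the minimal number of generators of its canonical ideal. *)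
Definition cm_type C (r : nat) : Prop := @min_num_generators R R^o C r.

Definition canonical_degree C (c : int) : Prop :=
  exists (e0 e1 : int) (l : nat),
    [/\ hilbert_coefficients C e0 e1, ideal_length [set: R] C l &
        c = e0 - l%:Z].

Definition reduction_number C a (r : nat) : Prop :=
  ideal_pow C r.+1 = ideal_mul (principal a) (ideal_pow C r) /\
  (forall s, (s < r)%N ->
     ideal_pow C s.+1 <> ideal_mul (principal a) (ideal_pow C s)).

(* The component C^(j+1) / a^j C of degree j of the Sally module. *)
Definition sally_component_length C a (j l : nat) : Prop :=
  ideal_length (ideal_pow C j.+1) (ideal_mul (principal (a ^+ j)) C) l.

(* In dimension one the Sally module has dimension at most one over R[aT], so
   its Hilbert function is eventually constant, with value its multiplicity. *)
Definition sally_multiplicity C a (s : nat) : Prop :=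
  exists N : nat, forall j, (N <= j)%N -> sally_component_length C a j s.

Definition almost_gorenstein C a (n : nat) : Prop :=
  (0 < n)%N /\ sally_multiplicity C a n.

End Invariants.

(* Main.v *)
From mathcomp Require Import all_boot all_order all_algebra.
From mathcomp Require Import boolp classical_sets.
From mathcomp Require Import ring zify.
Require Import Defs.

(** Write [C = (a, b)] with [(a)] the given minimal reduction; the element [a] is
    regular, and a minimal generator of [C] by Nakayama
    ([reduction_notin_mul], [two_generators]). The module [C^(j+1) / a C^j] is
    then cyclic, generated by [b^(j+1)]; let [d j] be its length. Multiplication by
    [b] maps [C^(j+1) / a C^j] onto [C^(j+2) / a C^(j+1)], so [d] is nonincreasing.

    All the invariants are read off [d]. The canonical degree is [d 0]
    ([canonical_degree_length]); the reduction number is the first zero of [d];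
    filtering [C^(j+1) / a^j C] shows that the multiplicity of the Sally module is
    [d 1 + d 2 + ...] ([sally_length]).

    Two properties of canonical ideals enter. First, [C : C = R] gives
    [a C : b^2 = (a) : b], hence [d 1 = d 0] ([step_ann01]). So the sum
    [d 1 + d 2 + ...] equals [3] exactly when the sequence [d 1, d 2, ...] is
    [3], or [2, 1], or [1, 1, 1], and the first two possibilities are the two
    cases of the theorem. Second, if [d 0 = 1] then [b / a] maps the maximal ideal
    to itself, and since [(C : m) / C] has length one, [b^3] lies in [a C^2] and
    [d 2 = 0] ([step_ann2_of_maximal]), which excludes [1, 1, 1].

    Both properties are deduced from the lengths of [Ext^1(R / m, C)] and
    [Ext^2(R / m, C)], computed on a free resolution of [R / m]. The length of
    [Ext^1] says that any two homomorphisms [m -> C] are proportional modulo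
    multiplications ([hom_proportional]). The vanishing of [Ext^2] yields that
    homomorphisms [m -> C / a C] killing [a] are multiplications
    ([hom_mod_lift]), then, by Noetherian induction, the same for every ideal
    containing [a] ([hom_mod_mult]), which is the injectivity of [C / a C] over
    [R / (a)]; the faithfulness of this injective hull is [C : C = R]
    ([canonical_faithful]). *)

Set Implicit Arguments.
Unset Strict Implicit.
Unset Printing Implicit Defensive.

Import GRing.Theory.
Local Open Scope classical_set_scope.
Local Open Scope ring_scope.

(** * Submodules, chains and length *)

Lemma neq_properW T (N M : set T) : N `<=` M -> N <> M -> N `<` M.
Proof. by move=> NM neq; split=> // MN; apply: neq; apply/seteqP. Qed.

Section Length.
Variables (R : comNzRingType) (V : lmodType R).
Implicit Types (N M P Q S : set V) (x y : V).

Lemma submoduleP N :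
  submodule N <-> N 0 /\ (forall r x y, N x -> N y -> N (r *: x + y)).
Proof.
rewrite /submodule /GRing.submod_closed; split=> -[N0 Nl]; split.
- by move: N0; rewrite inE.
- by move=> r x y Nx Ny; have := Nl r x y; rewrite !inE; apply.
- by rewrite inE.
- by move=> r x y; rewrite !inE; apply: Nl.
Qed.

Lemma submod0 N : submodule N -> N 0.
Proof. by case/submoduleP. Qed.

Lemma submodL N r x y : submodule N -> N x -> N y -> N (r *: x + y).
Proof. by case/submoduleP => _; apply. Qed.

Lemma submodD N x y : submodule N -> N x -> N y -> N (x + y).
Proof. by move=> sN Nx Ny; rewrite -[x]scale1r; apply: submodL. Qed.

Lemma submodZ N r x : submodule N -> N x -> N (r *: x).
Proof.
by move=> sN Nx; rewrite -[_ *: _]addr0; apply: submodL => //; exact: submod0.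
Qed.

Lemma submodN N x : submodule N -> N x -> N (- x).
Proof. by move=> sN Nx; rewrite -scaleN1r; apply: submodZ. Qed.

Lemma submodB N x y : submodule N -> N x -> N y -> N (x - y).
Proof. by move=> sN Nx Ny; apply: submodD => //; apply: submodN. Qed.

Lemma submodT : submodule [set: V].
Proof. exact/submoduleP. Qed.

Lemma submod_cap N M : submodule N -> submodule M -> submodule (N `&` M).
Proof.
move=> sN sM; apply/submoduleP; split; first by split; apply: submod0.
by move=> r x y [Nx Mx] [Ny My]; split; apply: submodL.
Qed.

Definition submod_sum N M : set V := [set z | exists x y, [/\ N x, M y & z = x + y]].

Lemma submod_submod_sum N M :
  submodule N -> submodule M -> submodule (submod_sum N M).
Proof.
move=> sN sM; apply/submoduleP; split.
  by exists 0, 0; split; [exact: submod0 | exact: submod0 | rewrite addr0].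
move=> r _ _ [x1 [y1 [Nx1 My1 ->]]] [x2 [y2 [Nx2 My2 ->]]].
exists (r *: x1 + x2), (r *: y1 + y2); split; [exact: submodL|exact: submodL|].
by rewrite scalerDr addrACA.
Qed.

Lemma submod_span S : submodule (span S).
Proof.
apply/submoduleP; split=> [N [sN _]|r x y Hx Hy N HN]; first exact: submod0.
by case: (HN) => sN _; apply: submodL; [|apply: Hx|apply: Hy].
Qed.

Lemma span_min S N x : submodule N -> S `<=` N -> span S x -> N x.
Proof. by move=> sN SN; apply: smallest_sub. Qed.

Lemma sub_span S x : S x -> span S x.
Proof. exact: sub_gen_smallest. Qed.

Lemma span_cons v (s : seq V) z :
  span [set` v :: s] z <-> exists r y, span [set` s] y /\ z = r *: v + y.
Proof.
split; last first.
  move=> [r [y [sy ->]]]; apply: (submodL r (submod_span _)).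
    by apply: sub_span; rewrite /= mem_head.
  apply: span_min sy => [|u /= us]; first exact: submod_span.
  by apply: sub_span; rewrite /= in_cons us orbT.
apply: (@span_min _ [set z | exists r y, span [set` s] y /\ z = r *: v + y]).
  apply/submoduleP; split.
    exists 0, 0; rewrite scale0r addr0; split=> //.
    exact: submod0 (submod_span _).
  move=> r _ _ [r1 [y1 [Hy1 ->]]] [r2 [y2 [Hy2 ->]]].
  exists (r * r1 + r2), (r *: y1 + y2); split.
    exact: (submodL r (submod_span _) Hy1 Hy2).
  by rewrite scalerDl scalerDr scalerA addrACA.
move=> u /=; rewrite in_cons => /orP[/eqP->|us].
  by exists 1, 0; rewrite scale1r addr0; split=> //; exact: submod0 (submod_span _).
by exists 0, u; rewrite scale0r add0r; split=> //; exact: sub_span.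
Qed.

Lemma span_nil z : span [set` [::]] z -> z = 0 :> V.
Proof.
apply: (@span_min _ [set 0]) => [|//].
by apply/submoduleP; split=> // r x y -> ->; rewrite scaler0 addr0.
Qed.

Definition chainable N M (l : nat) : Prop := exists F, submodule_chain M N l F.

Lemma chainable_nil N : submodule N -> chainable N N 0.
Proof. by move=> sN; exists (fun=> N); split. Qed.

Lemma chainable0 N M : chainable N M 0 -> N = M.
Proof. by case=> F [<- <-]. Qed.

Lemma chainable_rcons N P M l :
  chainable N P l -> submodule M -> P `<` M -> chainable N M l.+1.
Proof.
move=> [F [F0 Fl sF ltF]] sM PM.
exists (fun i => if (i <= l)%N then F i else M); split.
- by rewrite leq0n.
- by rewrite ltnn.
- by move=> i; case: ifP => // il _; apply: sF.
- move=> i /=; rewrite ltnS => il; rewrite il.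
  move: il; rewrite leq_eqVlt => /orP[/eqP->|il]; first by rewrite ltnn Fl.
  by rewrite il; apply: ltF.
Qed.

Lemma chainable_belast N M l : chainable N M l.+1 ->
  exists P, [/\ chainable N P l, submodule M & P `<` M].
Proof.
move=> [F [F0 Fl sF ltF]]; exists (F l); split.
- exists F; split=> // i il; first by apply: sF; apply: leqW.
  by apply: ltF; apply: ltnW.
- by rewrite -Fl; apply: sF.
- by rewrite -Fl; apply: ltF.
Qed.

Lemma chainable_submod N M l : chainable N M l -> submodule N /\ submodule M.
Proof.
by move=> [F [<- <- sF _]]; split; apply: sF.
Qed.

Lemma chainable_sub N M l : chainable N M l -> N `<=` M.
Proof.
elim: l M => [|l IH] M; first by move/chainable0->.
move=> /chainable_belast[P [/IH NP _ [PM _]]].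
exact: subset_trans PM.
Qed.

Lemma chainable_cat N P M l1 l2 :
  chainable N P l1 -> chainable P M l2 -> chainable N M (l1 + l2).
Proof.
move=> c1; elim: l2 M => [|l IH] M; first by move/chainable0 <-; rewrite addn0.
move=> /chainable_belast[Q [/IH cQ sM QM]].
by rewrite addnS; apply: chainable_rcons QM.
Qed.

(** A strict step of a chain stays strict after intersecting with [P] or after
    adding [P], by the modular law; hence a chain through [P] can be extracted
    whose two halves are together at least as long. *)
Lemma chainable_modular P N M l : submodule P -> chainable N M l ->
  exists l1 l2, [/\ chainable (N `&` P) (M `&` P) l1,
    chainable (submod_sum N P) (submod_sum M P) l2 & (l <= l1 + l2)%N].
Proof.
move=> sP; elim: l M => [|l IH] M.
  move=> c; have [sN _] := chainable_submod c; rewrite -(chainable0 c).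
  exists 0%N, 0%N; split=> //; apply: chainable_nil.
    exact: submod_cap.
  exact: submod_submod_sum.
move=> /chainable_belast[Q [cQ sM [QM nMQ]]].
have [l1 [l2 [c1 c2 le]]] := IH _ cQ.
have [_ sQ] := chainable_submod cQ.
have capQM : Q `&` P `<=` M `&` P by move=> x [/QM].
have sumQM : submod_sum Q P `<=` submod_sum M P.
  by move=> _ [x [y [/QM Mx Py ->]]]; exists x, y.
have [Ecap|ncap] := pselect (Q `&` P = M `&` P); last first.
  have c1' : chainable (N `&` P) (M `&` P) l1.+1.
    apply: chainable_rcons c1 _ _; first exact: submod_cap.
    exact: neq_properW.
  have [Esum|nsum] := pselect (submod_sum Q P = submod_sum M P).
    by exists l1.+1, l2; split; rewrite -?Esum // addSn ltnS.
  exists l1.+1, l2.+1; split=> //; last by rewrite addSn addnS ltnS leqW.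
  apply: chainable_rcons c2 _ _; first exact: submod_submod_sum.
  exact: neq_properW.
exists l1, l2.+1; split; rewrite -?Ecap // ?addnS ?ltnS //.
apply: chainable_rcons c2 _ _; first exact: submod_submod_sum.
split=> // MQ; apply: nMQ => x Mx.
have /MQ[q [p [Qq Pp xE]]] : submod_sum M P x.
  by exists x, 0; split=> //; rewrite ?addr0 //; exact: submod0.
have : (Q `&` P) p.
  rewrite Ecap; split=> //.
  suff -> : p = x - q by apply: submodB => //; apply: QM.
  by rewrite xE addrAC subrr add0r.
by move=> [Qp _]; rewrite xE; apply: submodD.
Qed.

Lemma chainable_through N P M l : submodule P -> N `<=` P -> P `<=` M ->
  chainable N M l ->
  exists l1 l2, [/\ chainable N P l1, chainable P M l2 & (l <= l1 + l2)%N].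
Proof.
move=> sP NP PM c; have [sN sM] := chainable_submod c.
have [l1 [l2 []]] := chainable_modular sP c.
have -> : N `&` P = N by apply/seteqP; split=> [x []|x Nx] //; split=> //; apply: NP.
have -> : M `&` P = P by apply/seteqP; split=> [x []|x Px] //; split=> //; apply: PM.
have -> : submod_sum N P = P.
  apply/seteqP; split=> [_ [x [y [/NP Px Py ->]]]|x Px]; first exact: submodD.
  by exists 0, x; rewrite add0r; split=> //; exact: submod0.
have -> : submod_sum M P = M.
  apply/seteqP; split=> [_ [x [y [Mx /PM My ->]]]|x Mx]; first exact: submodD.
  by exists x, 0; rewrite addr0; split=> //; exact: submod0.
by move=> c1 c2 le; exists l1, l2.
Qed.

Lemma length_chainable M N l : length_quot M N l -> chainable N M l.
Proof. by case. Qed.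

Lemma length_sub M N l : length_quot M N l -> N `<=` M.
Proof. by move/length_chainable/chainable_sub. Qed.

Lemma length_max M N l l' : length_quot M N l -> chainable N M l' -> (l' <= l)%N.
Proof. by move=> [_ ub] [F]; apply: ub. Qed.

Lemma lengthI M N l : chainable N M l ->
  (forall l', chainable N M l' -> (l' <= l)%N) -> length_quot M N l.
Proof. by move=> c ub; split=> // l' F cF; apply: ub; exists F. Qed.

Lemma length_uniq M N l l' : length_quot M N l -> length_quot M N l' -> l = l'.
Proof.
move=> h h'; apply/eqP; rewrite eqn_leq.
by rewrite (length_max h' (length_chainable h)) (length_max h (length_chainable h')).
Qed.

Lemma length_bounded M N l B : chainable N M l ->
  (forall l', chainable N M l' -> (l' <= B)%N) -> exists k, length_quot M N k.
Proof.
move=> c ub.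
have exP : exists i, `[< chainable N M i >] by exists l; apply/asboolP.
have ubP i : `[< chainable N M i >] -> (i <= B)%N by move/asboolP/ub.
case: (ex_maxnP exP ubP) => k /asboolP ck kmax; exists k; apply: lengthI => //.
by move=> l' cl'; apply: kmax; apply/asboolP.
Qed.

Lemma length_add M P N l1 l2 :
  length_quot M P l1 -> length_quot P N l2 -> length_quot M N (l1 + l2).
Proof.
move=> h1 h2; have c1 := length_chainable h1; have c2 := length_chainable h2.
apply: lengthI => [|l' c']; first by rewrite addnC; apply: chainable_cat c2 c1.
have [_ sP] := chainable_submod c2.
have [k1 [k2 [d1 d2 le]]] :=
  chainable_through sP (chainable_sub c2) (chainable_sub c1) c'.
rewrite (leq_trans le) // addnC; apply: leq_add.
  exact: length_max h1 d2.
exact: length_max h2 d1.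
Qed.

Lemma length_split M P N l : length_quot M N l -> submodule P ->
    N `<=` P -> P `<=` M ->
  exists l1 l2, [/\ length_quot M P l1, length_quot P N l2 & l = (l1 + l2)%N].
Proof.
move=> h sP NP PM.
have [k1 [k2 [d1 d2 _]]] := chainable_through sP NP PM (length_chainable h).
have [l1 h1] : exists l1, length_quot M P l1.
  apply: (@length_bounded _ _ k2 l) => // l' c'.
  exact: leq_trans (leq_addl k1 _) (length_max h (chainable_cat d1 c')).
have [l2 h2] : exists l2, length_quot P N l2.
  apply: (@length_bounded _ _ k1 l) => // l' c'.
  exact: leq_trans (leq_addr k2 _) (length_max h (chainable_cat c' d2)).
by exists l1, l2; split=> //; apply: length_uniq h (length_add h1 h2).
Qed.

Lemma length_refl N : submodule N -> length_quot N N 0.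
Proof.
move=> sN; apply: lengthI => [|[//|l']]; first exact: chainable_nil.
move=> /chainable_belast[P [c _ [_ []]]]; exact: chainable_sub c.
Qed.

Lemma length0 M N : length_quot M N 0 -> M = N.
Proof. by move/length_chainable/chainable0. Qed.

Lemma length_simple M N : submodule N -> submodule M -> N `<` M ->
  (forall P, submodule P -> N `<` P -> P `<=` M -> P = M) -> length_quot M N 1.
Proof.
move=> sN sM NM simple; apply: lengthI => [|[//|[//|l']]].
  by apply: chainable_rcons NM => //; apply: chainable_nil.
move=> /chainable_belast[P [c _ [PM nMP]]].
have [Q [cQ sP [QP nPQ]]] := chainable_belast c.
suff E : P = M by case: nMP; rewrite E.
apply: simple => //; split; first exact: chainable_sub c.
by move=> PN; apply: nPQ; apply: subset_trans PN (chainable_sub cQ).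
Qed.

End Length.

(** ** Length along linear maps *)

Section LengthMap.
Variables (R : comNzRingType) (V W : lmodType R).

Lemma chainable_map (N M : set V) (N' M' : set W) (phi : set V -> set W) l :
    (forall P, submodule P -> N `<=` P -> P `<=` M -> submodule (phi P)) ->
    (forall P Q, submodule P -> submodule Q -> N `<=` P -> P `<` Q ->
       Q `<=` M -> phi P `<` phi Q) ->
    phi N = N' -> phi M = M' ->
  chainable N M l -> chainable N' M' l.
Proof.
move=> sphi ltphi <- <-.
elim: l M sphi ltphi => [|l IH] M sphi ltphi.
  move=> c; have [sN _] := chainable_submod c; rewrite -(chainable0 c).
  by apply: chainable_nil; apply: sphi => //; rewrite (chainable0 c).
move=> /chainable_belast[P [c sM PM]]; have [_ sP] := chainable_submod c.
have NP := chainable_sub c; have [leM _] := PM.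
apply: (@chainable_rcons _ _ _ (phi P)).
- apply: IH c => [Q sQ NQ QP|Q Q' sQ sQ' NQ QQ' Q'P].
    by apply: sphi => //; apply: subset_trans leM.
  by apply: ltphi => //; apply: subset_trans leM.
- by apply: sphi => //; apply: subset_trans leM.
- exact: ltphi.
Qed.

(** The correspondence theorem: [f] induces an isomorphism between [M / N] and
    [M' / N'], hence a bijection between the submodules in between. *)
Lemma length_iso (f : V -> W) (M N : set V) (M' N' : set W) l :
    (forall r x y, f (r *: x + y) = r *: f x + f y) ->
    submodule M' -> submodule N' -> N' `<=` M' ->
    (forall x, M x -> M' (f x)) ->
    (forall y, M' y -> exists x, M x /\ N' (y - f x)) ->
    (forall x, M x -> (N x <-> N' (f x))) ->
  length_quot M N l -> length_quot M' N' l.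
Proof.
move=> flin sM' sN' NM' fM fsurj fker h.
have c := length_chainable h; have [sN sM] := chainable_submod c.
have NM := chainable_sub c.
have f0 : f 0 = 0.
  by have := flin (-1) 0 0; rewrite scaler0 addr0 => ->; rewrite scaleN1r addNr.
have flB x y : f (x - y) = f x - f y.
  by rewrite addrC -scaleN1r flin scaleN1r addrC.
apply: lengthI.
  pose phi (P : set V) := submod_sum [set f x | x in P] N'.
  have sphi P : submodule P -> submodule (phi P).
    move=> sP; apply: submod_submod_sum => //.
    apply/submoduleP; split; first by exists 0 => //; exact: submod0.
    move=> r _ _ [x Px <-] [y Py <-]; exists (r *: x + y); last exact: flin.
    exact: submodL.
  apply: (@chainable_map N M N' M' phi l) => //.
  - by move=> P sP _ _; apply: sphi.
  - move=> P Q sP sQ NP [PQ nQP] QM; split.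
      move=> _ [_ [y [[x Px <-] Ny ->]]]; exists (f x), y; split=> //.
      by exists x => //; exact: PQ.
    move=> QP; apply: nQP => x Qx.
    have /QP [_ [y [[p Pp <-] Ny E]]] : phi Q (f x).
      by exists (f x), 0; rewrite addr0; split; [exists x| exact: submod0|].
    suff /NP Pxp : N (x - p).
      by rewrite -[x](subrK p); apply: submodD.
    apply/fker; first by apply: submodB => //; [exact: QM|exact/QM/PQ].
    by rewrite flB E addrAC subrr add0r.
  - apply/seteqP; split=> [_ [_ [y [[x Nx <-] Ny ->]]]|y Ny].
      by apply: submodD => //; apply/fker => //; exact: NM.
    exists 0, y; rewrite add0r; split=> //.
    by exists 0 => //; exact: submod0.
  - apply/seteqP; split=> [_ [_ [y [[x Mx <-] /NM' My ->]]]|y My].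
      by apply: submodD => //; exact: fM.
    have [x [Mx Ny]] := fsurj y My; exists (f x), (y - f x).
    by split=> //; [exists x | rewrite addrC subrK].
move=> l' c'; apply: length_max h _.
pose psi (Q : set W) := [set x | M x /\ Q (f x)].
have spsi Q : submodule Q -> submodule (psi Q).
  move=> sQ; apply/submoduleP; split.
    by split; rewrite ?f0; exact: submod0.
  by move=> r x y [Mx Qx] [My Qy]; split; rewrite ?flin; exact: submodL.
have strict Q Q' : submodule Q -> submodule Q' -> N' `<=` Q -> Q `<` Q' ->
    Q' `<=` M' -> psi Q `<` psi Q'.
  move=> sQ sQ' NQ [QQ' nQQ'] QM; split; first by move=> x [Mx /QQ'].
  move=> psiQ; apply: nQQ' => y Qy.
  have [x [Mx Ny]] := fsurj y (QM _ Qy).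
  have Q'x : Q' (f x).
    rewrite -[f x](subKr y); apply: submodB => //; exact/QQ'/NQ.
  have [_ Qx] := psiQ x (conj Mx Q'x).
  by rewrite -[y](subrK (f x)); apply: submodD => //; exact: NQ.
have chainable_back (l0 : nat) : chainable N' M' l0 -> chainable N M l0.
  have EN : psi N' = N.
    apply/seteqP; split=> [x [Mx /fker]|x Nx]; first exact.
    by split; [exact: NM | apply/fker => //; exact: NM].
  have EM : psi M' = M.
    by apply/seteqP; split=> [x []|x Mx] //; split=> //; exact: fM.
  rewrite -EN -EM.
  elim: l0 {-2}M' (@subset_refl _ M') => [|k IH] P PM'.
    by move/chainable0 <-; apply: chainable_nil; exact: spsi.
  move=> /chainable_belast[Q [cQ sP QP]].
  have [sN0 sQ] := chainable_submod cQ.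
  apply: (@chainable_rcons _ _ _ (psi Q)) => //; last 2 first.
  - exact: spsi.
  - by apply: strict => //; exact: chainable_sub cQ.
  by apply: IH => //; apply: subset_trans PM'; case: QP.
exact: chainable_back.
Qed.

End LengthMap.

(** * Ideals of a Noetherian local ring *)

Section Ideals.
Variable R : comNzRingType.
Implicit Types (I J N m : set R) (x y r a : R).

Lemma idealP I : ideal I <-> I 0 /\ (forall r x y, I x -> I y -> I (r * x + y)).
Proof. exact: (@submoduleP R R^o I). Qed.

Lemma ideal0 I : ideal I -> I 0.
Proof. by case/idealP. Qed.

Lemma idealL I r x y : ideal I -> I x -> I y -> I (r * x + y).
Proof. by case/idealP => _; apply. Qed.

Lemma idealD I x y : ideal I -> I x -> I y -> I (x + y).
Proof. exact: (@submodD R R^o I). Qed.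

Lemma idealB I x y : ideal I -> I x -> I y -> I (x - y).
Proof. exact: (@submodB R R^o I). Qed.

Lemma idealN I x : ideal I -> I x -> I (- x).
Proof. exact: (@submodN R R^o I). Qed.

Lemma idealMl I r x : ideal I -> I x -> I (r * x).
Proof. exact: (@submodZ R R^o I). Qed.

Lemma idealMr I r x : ideal I -> I x -> I (x * r).
Proof. by rewrite mulrC; exact: idealMl. Qed.

Lemma ideal_sum I (T : finType) (F : T -> R) :
  ideal I -> (forall i, I (F i)) -> I (\sum_i F i).
Proof.
move=> iI IF; elim/big_ind: _ => [|x y|i _]; [exact: ideal0|exact: idealD|exact: IF].
Qed.

Lemma idealT : ideal [set: R].
Proof. exact: submodT. Qed.

Lemma ideal_ideal_span (S : set R) : ideal (ideal_span S).
Proof. exact: submod_span. Qed.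

Lemma ideal_span_min (S : set R) I x :
  ideal I -> S `<=` I -> ideal_span S x -> I x.
Proof. exact: span_min. Qed.

Lemma proper_idlP I : proper_idl I <-> ideal I /\ ~ I 1.
Proof.
split=> [[I0 I1 Il]|[/idealP[I0 Il] I1]].
  split; last by move: I1; rewrite notin_setE.
  apply/idealP; split; first by move: I0; rewrite inE.
  by move=> r x y Ix Iy; have := Il r x y; rewrite !inE; apply.
split; [by rewrite inE | by rewrite notin_setE |].
by move=> r x y; rewrite !inE; apply: Il.
Qed.

Lemma ideal1 I : ideal I -> I 1 -> I = [set: R].
Proof.
move=> iI I1; apply/seteqP; split=> // x _.
by rewrite -[x]mulr1; apply: idealMl.
Qed.

Lemma principalP a x : principal a x <-> exists r, x = r * a.
Proof.
split=> [|[r ->]]; last first.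
  by apply: (idealMl _ (ideal_ideal_span _)); exact: sub_span.
apply: (@ideal_span_min _ [set x | exists r, x = r * a]).
  apply/idealP; split; first by exists 0; rewrite mul0r.
  by move=> r _ _ [s ->] [t ->]; exists (r * s + t); ring.
by move=> _ ->; exists 1; rewrite mul1r.
Qed.

Lemma ideal_principal a : ideal (principal a).
Proof. exact: ideal_ideal_span. Qed.

Lemma ideal_mul_mem I J x y : I x -> J y -> ideal_mul I J (x * y).
Proof. by move=> Ix Jy; apply: sub_span; exists x, y. Qed.

Lemma ideal_mul_min I J N z : ideal N ->
  (forall x y, I x -> J y -> N (x * y)) -> ideal_mul I J z -> N z.
Proof.
move=> iN H; apply: ideal_span_min => // _ [x [y [Ix Jy ->]]]; exact: H.
Qed.

Lemma ideal_mul_principalP a J x : ideal J ->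
  ideal_mul (principal a) J x <-> exists c, J c /\ x = a * c.
Proof.
move=> iJ; split=> [|[c [Jc ->]]]; last first.
  by apply: ideal_mul_mem => //; apply/principalP; exists 1; rewrite mul1r.
apply: (@ideal_mul_min _ _ [set x | exists c, J c /\ x = a * c]).
  apply/idealP; split; first by exists 0; rewrite mulr0; split=> //; exact: ideal0.
  move=> r _ _ [c [Jc ->]] [d [Jd ->]]; exists (r * c + d).
  by split; [exact: idealL | ring].
move=> u y /principalP[r ->] Jy; exists (r * y); split; last by ring.
exact: idealMl.
Qed.

Lemma ideal_ideal_mul I J : ideal (ideal_mul I J).
Proof. exact: ideal_ideal_span. Qed.

Lemma ideal_ideal_pow I n : ideal (ideal_pow I n).
Proof. by case: n => [|n]; [exact: idealT | exact: ideal_ideal_mul]. Qed.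

Lemma radical_pow I x n : radical I x -> radical (ideal_pow I n) x.
Proof.
move=> [k Ik]; exists (k * n)%N; elim: n => [//|n IH].
by rewrite mulnS exprD; apply: ideal_mul_mem.
Qed.

Lemma radical_sub I J : I `<=` J -> radical I `<=` radical J.
Proof. by move=> IJ x [n /IJ Jx]; exists n. Qed.

(** In a Noetherian ring, a family of ideals without maximal element would
    contain an infinite strictly ascending chain, whose union is generated by
    finitely many elements, all of which lie in some term of the chain. *)
Lemma noetherian_ind (P : set R -> Prop) : noetherian R ->
  (forall I, ideal I -> (forall J, ideal J -> I `<` J -> P J) -> P I) ->
  forall I, ideal I -> P I.
Proof.
move=> noeth step I iI; apply: contrapT => nPI.
pose bad := {J : set R | ideal J /\ ~ P J}.
have next (J : bad) : {J' : bad | sval J `<` sval J'}.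
  apply: cid; case: J => J [iJ nPJ] /=; apply: contrapT => nex.
  apply: nPJ; apply: step => // J' iJ' JJ'; apply: contrapT => nPJ'.
  by apply: nex; exists (exist _ J' (conj iJ' nPJ')).
pose F n : bad := iter n (fun B : bad => sval (next B)) (exist _ I (conj iI nPI)).
have ltF n : sval (F n) `<` sval (F n.+1) by exact: (svalP (next (F n))).
have idF n : ideal (sval (F n)) by case: (svalP (F n)).
have leF i j : (i <= j)%N -> sval (F i) `<=` sval (F j).
  elim: j => [|j IH]; first by rewrite leqn0 => /eqP->.
  rewrite leq_eqVlt => /orP[/eqP-> //|/IH le].
  by apply: subset_trans le _; case: (ltF j).
pose U := [set x | exists n, sval (F n) x].
have iU : ideal U.
  apply/idealP; split; first by exists 0%N; apply: ideal0; exact: idF.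
  move=> r x y [i Fx] [j Fy]; exists (maxn i j); apply: idealL; first exact: idF.
    by apply: (leF i) => //; exact: leq_maxl.
  by apply: (leF j) => //; exact: leq_maxr.
have [s Us] := noeth _ iU.
have [n sub] : exists n, [set` s] `<=` sval (F n).
  have : [set` s] `<=` U by move=> x xs; rewrite Us; exact: sub_span.
  elim: {Us} s => [|v s IH] sU; first by exists 0%N.
  have [n sn] : exists n, [set` s] `<=` sval (F n).
    by apply: IH => x xs; apply: sU; rewrite /= in_cons xs orbT.
  have [k vk] : U v by apply: sU; rewrite /= mem_head.
  exists (maxn k n) => x; rewrite /= in_cons => /orP[/eqP->|xs].
    by apply: leF vk; exact: leq_maxl.
  by apply: (leF n); [exact: leq_maxr | exact: sn].
have [_ []] := ltF n => x Fx.
have : U x by exists n.+1.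
by rewrite Us; apply: span_min => //; exact: idF.
Qed.

Section Local.
Variable m : set R.
Hypothesis Hloc : noetherian_local m.

Lemma local_noetherian : noetherian R.
Proof. by case: Hloc. Qed.

Lemma local_ideal : ideal m.
Proof. by case: Hloc => _ [/proper_idlP[]]. Qed.

Lemma local_proper : ~ m 1.
Proof. by case: Hloc => _ [/proper_idlP[]]. Qed.

Lemma proper_sub_local I : ideal I -> ~ I 1 -> I `<=` m.
Proof.
move: I; apply: noetherian_ind; first exact: local_noetherian.
move=> I iI IH nI1.
have [maxI|nmax] := pselect (maximal_ideal I).
  by case: Hloc => _ _ /(_ I maxI) ->.
suff [J [iJ IJ nJ1]] : exists J, [/\ ideal J, I `<` J & ~ J 1].
  by apply: subset_trans (IH J iJ IJ nJ1); case: IJ.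
apply: contrapT => nex; apply: nmax; split; first exact/proper_idlP.
move=> J /proper_idlP[iJ nJ1] IJ; apply: contrapT => JI; apply: nex.
by exists J; split=> //; apply: neq_properW => // /esym.
Qed.

Lemma local_unit x : ~ m x -> exists y, y * x = 1.
Proof.
move=> nmx; apply: contrapT => nex; apply: nmx.
apply: (@proper_sub_local (principal x)).
- exact: ideal_principal.
- by move=> /principalP[r E]; apply: nex; exists r.
- by apply/principalP; exists 1; rewrite mul1r.
Qed.

Lemma local_unit_subr r : m r -> exists y, y * (1 - r) = 1.
Proof.
move=> mr; apply: local_unit => m1r; apply: local_proper.
by rewrite -[1](subrK r); apply: idealD => //; exact: local_ideal.
Qed.

(** If [v = r v + y] with [r] in the maximal ideal and [y] in the span of the
    other generators, then [v] is redundant because [1 - r] is a unit. *)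
Lemma nakayama (N : set R) : ideal N ->
  (forall x, N x -> ideal_mul m N x) -> forall x, N x -> x = 0.
Proof.
move=> iN; have [s ->] := local_noetherian iN.
elim: s => [|v s IH] Hs x; first exact: span_nil.
have im := local_ideal; have iS : ideal (@span R R^o [set` s]) by exact: submod_span.
have split_v u : ideal_mul m (@span R R^o [set` v :: s]) u ->
    exists r y, [/\ m r, @span R R^o [set` s] y & u = r * v + y].
  apply: (@ideal_mul_min _ _ [set u | exists r y, [/\ m r, @span R R^o [set` s] y
      & u = r * v + y]]).
    apply/idealP; split.
      by exists 0, 0; rewrite mul0r addr0; split=> //; [exact: ideal0 im | exact: ideal0 iS].
    move=> r _ _ [r1 [y1 [mr1 sy1 ->]]] [r2 [y2 [mr2 sy2 ->]]].
    exists (r * r1 + r2), (r * y1 + y2); split; last by ring.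
      exact: idealL.
    exact: (idealL r iS).
  move=> c z mc /span_cons[r [y [sy ->]]]; exists (c * r), (c * y); split.
  - exact: idealMr.
  - exact: (idealMl c iS).
  - by rewrite /GRing.scale /=; ring.
suff E : @span R R^o [set` v :: s] = @span R R^o [set` s].
  rewrite E; apply: IH => u; rewrite -E; exact: Hs.
have [r [y [mr sy vE]]] : exists r y, [/\ m r, @span R R^o [set` s] y & v = r * v + y].
  apply: split_v; apply: Hs; apply/(@span_cons R R^o); exists 1, 0.
  by split; [exact: ideal0 iS | rewrite scale1r addr0].
have [u uE] := local_unit_subr mr.
have sv : @span R R^o [set` s] v.
  suff -> : v = u * y by exact: (idealMl u iS).
  have -> : y = (1 - r) * v by rewrite mulrBl mul1r {1}vE addrAC subrr add0r.
  by rewrite mulrA uE mul1r.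
apply/seteqP; split=> z.
  move=> /span_cons[t [w [sw ->]]].
  exact: (idealL t iS).
by move=> sz; apply/(@span_cons R R^o); exists 0, z; rewrite scale0r add0r.
Qed.

(** Multiplying [x] by the largest power of each generator of the maximal ideal
    that keeps it outside [I] produces a socle element of [R / I]. *)
Lemma socle_element I x : ideal I -> m `<=` radical I -> ~ I x ->
  exists y, ~ I (y * x) /\ forall r, m r -> I (r * (y * x)).
Proof.
move=> iI mI nIx.
have [s mE] := local_noetherian local_ideal.
have [y [nIy Hy]] : exists y, ~ I (y * x) /\ forall g, g \in s -> I (g * (y * x)).
  have : forall g, g \in s -> radical I g.
    by move=> g gs; apply: mI; rewrite mE; exact: sub_span.
  elim: {mE} s => [|g s IH] rad; first by exists 1; rewrite mul1r.
  have [y [nIy Hy]] : exists y, ~ I (y * x) /\ forall g, g \in s -> I (g * (y * x)).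
    by apply: IH => h hs; apply: rad; rewrite in_cons hs orbT.
  have exn : exists n, `[< I (g ^+ n * (y * x)) >].
    have [n In] : radical I g by apply: rad; rewrite mem_head.
    by exists n; apply/asboolP; apply: idealMr.
  case: (ex_minnP exn) => -[|n] /asboolP In nmin.
    by move: In; rewrite mul1r.
  exists (g ^+ n * y); split=> [In'|h].
    by have := nmin n (asboolT _); rewrite ltnn mulrA => /(_ In').
  rewrite in_cons => /orP[/eqP->|hs].
    by rewrite exprS in In; rewrite mulrA mulrA -mulrA.
  have -> : h * (g ^+ n * y * x) = g ^+ n * (h * (y * x)) by ring.
  by apply: idealMl => //; exact: Hy.
exists y; split=> // r; rewrite {1}mE.
apply: (@ideal_span_min _ [set r | I (r * (y * x))]).
  apply/idealP; split; first by rewrite /= mul0r; exact: ideal0.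
  by move=> c u v /= Iu Iv; rewrite mulrDl -mulrA; exact: idealL.
by move=> g gs; exact: Hy.
Qed.

Definition adjoin I z : set R := [set x | exists i r, I i /\ x = i + r * z].

Lemma ideal_adjoin I z : ideal I -> ideal (adjoin I z).
Proof.
move=> iI; apply/idealP; split.
  by exists 0, 0; rewrite mul0r addr0; split=> //; exact: ideal0.
move=> r _ _ [i [s [Ii ->]]] [j [t [Ij ->]]].
by exists (r * i + j), (r * s + t); split; [exact: idealL | ring].
Qed.

Lemma adjoin_sub I z : I `<=` adjoin I z.
Proof. by move=> x Ix; exists x, 0; rewrite mul0r addr0. Qed.

Lemma adjoin_mem I z : ideal I -> adjoin I z z.
Proof. by move=> iI; exists 0, 1; rewrite mul1r add0r; split=> //; exact: ideal0. Qed.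

Lemma adjoin_proper I z : ideal I -> ~ I z -> I `<` adjoin I z.
Proof.
by move=> iI nIz; split; [exact: adjoin_sub | move=> /(_ z (adjoin_mem z iI))].
Qed.

Lemma length_adjoin I z : ideal I -> ~ I z -> (forall r, m r -> I (r * z)) ->
  ideal_length (adjoin I z) I 1.
Proof.
move=> iI nIz mz; apply: length_simple => //.
- exact: ideal_adjoin.
- exact: adjoin_proper.
move=> P sP [IP nPI] PIz; apply/seteqP; split=> //.
have [x [Px nIx]] : exists x, P x /\ ~ I x.
  by apply: contrapT => nex; apply: nPI => x Px; apply: contrapT => nIx; apply: nex; exists x.
have [i [r [Ii xE]]] := PIz x Px.
have [u uE] : exists u, u * r = 1.
  by apply: local_unit => mr; apply: nIx; rewrite xE; apply: idealD => //; exact: mz.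
have Pz : P z.
  suff -> : z = u * (x - i).
    by apply: (@idealMl P) => //; apply: (@idealB P) => //; exact: IP.
  by rewrite xE addrAC subrr add0r mulrA uE mul1r.
move=> _ [j [t [Ij ->]]]; apply: (@idealD P) => //; first exact: IP.
exact: (@idealMl P).
Qed.

Lemma finite_length I : ideal I -> m `<=` radical I ->
  exists l, ideal_length [set: R] I l.
Proof.
move: I; apply: noetherian_ind; first exact: local_noetherian.
move=> I iI IH mI.
have [I1|nI1] := pselect (I 1).
  by exists 0%N; rewrite (ideal1 iI I1); apply: length_refl; exact: idealT.
have [y [nIy my]] := socle_element iI mI nI1.
have [l hl] : exists l, ideal_length [set: R] (adjoin I (y * 1)) l.
  apply: IH; first exact: ideal_adjoin.
    exact: adjoin_proper.
  exact: subset_trans mI (radical_sub (@adjoin_sub _ _)).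
exists (l + 1)%N; apply: length_add hl _; exact: length_adjoin.
Qed.

Lemma length_one_eq_max I : ideal I -> ideal_length [set: R] I 1 -> I = m.
Proof.
move=> iI h.
have nI1 : ~ I 1.
  move=> I1; rewrite (ideal1 iI I1) in h.
  by have := length_uniq h (length_refl idealT).
have Im := proper_sub_local iI nI1.
have [l1 [l2 [h1 h2 E]]] := length_split h local_ideal Im (@subsetT _ _).
case: l1 h1 E => [/length0 E|l1 _ E].
  by case: local_proper; rewrite -E.
by move: l2 h2 E => [/length0-> //|l2 _]; rewrite addSn addnS.
Qed.

End Local.
End Ideals.

(** * Extending homomorphisms into a canonical ideal *)

Section CanonicalIdeal.
Variables (R : comNzRingType) (m C : set R).
Hypotheses (Hloc : noetherian_local m) (Hdim : krull_dim R 1)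
  (HC : canonical_ideal m C).
Implicit Types (I J : set R) (g h : R -> R) (x y r s : R).

Lemma canonical_ideal_ideal : ideal C.
Proof. by case: HC => -[[/proper_idlP[]]]. Qed.

Lemma canonical_ideal_proper : ~ C 1.
Proof. by case: HC => -[[/proper_idlP[]]]. Qed.

Lemma canonical_ideal_radical : radical C = m.
Proof. by case: HC => -[]. Qed.

Let iC := canonical_ideal_ideal.

Lemma krull_dim_uniq d d' : krull_dim R d -> krull_dim R d' -> d = d'.
Proof.
move=> [[P cP] ub] [[P' cP'] ub']; apply/eqP.
by rewrite eqn_leq (ub' _ _ cP) (ub _ _ cP').
Qed.

(** As the dimension is one, [Ext^1] of the residue field into [C] has length one
    and [Ext^2] vanishes. *)
Lemma canonical_ext : exists (K : lmodType R) (f : {linear K -> R^o})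
    (n : nat -> nat) (d : forall i, 'M[R]_(res_rank n i.+1, res_rank n i)),
  [/\ injective f, range f = C, free_resolution d m, ext_length d K 1 1 &
      ext_length d K 2 0].
Proof.
have [_ [K [f [[_ [e [he [n [d [res ext]]]]] inj fC]]]]] := HC.
have e1 := krull_dim_uniq he Hdim; rewrite e1 in ext.
by exists K, f, n, d; split=> //.
Qed.

Section Resolution.
Variables (K : lmodType R) (f : {linear K -> R^o}) (n : nat -> nat)
  (d : forall i, 'M[R]_(res_rank n i.+1, res_rank n i)).
Hypotheses (f_inj : injective f) (fC : range f = C) (Hres : free_resolution d m).

Let gen (k : 'I_(n 0%N)) : R := d 0%N k ord0.

Let mE x : m x <-> exists w : 'I_(n 0%N) -> R, x = \sum_k w k * gen k.
Proof.
case: Hres => [H _]; rewrite H; split=> -[w E].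
  exists (w 0); have /matrixP/(_ 0 0) := E.
  by rewrite !mxE eqxx mulr1n.
exists (\row_k w k); apply/matrixP => i j; rewrite !ord1 !mxE eqxx mulr1n E.
by apply: eq_bigr => k _; rewrite mxE.
Qed.

Let gen_m k : m (gen k).
Proof.
apply/mE; exists (fun j => (j == k)%:R).
by rewrite (bigD1 k) //= eqxx mul1r big1 ?addr0 // => j /negPf->; rewrite mul0r.
Qed.

Let d_comp i : d i.+1 *m d i = 0.
Proof.
apply/row_matrixP => j; rewrite row_mul row0.
case: Hres => [_ /(_ i)] H; apply/H.
by exists (delta_mx 0 j); rewrite -rowE.
Qed.

Let d1_gen j : \sum_k d 1%N j k * gen k = 0.
Proof. by have /matrixP/(_ j 0) := d_comp 0; rewrite !mxE. Qed.

Let fS (T : finType) (c : T -> R) (v : T -> K) :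
  f (\sum_k c k *: v k) = \sum_k c k * f (v k).
Proof. by rewrite linear_sum; apply: eq_bigr => k _; rewrite linearZ. Qed.

Let f_surj x : C x -> exists v : K, f v = x.
Proof. by rewrite -fC => -[v _ <-]; exists v. Qed.

Let fCv v : C (f v).
Proof. by rewrite -fC; exists v. Qed.

(** Homomorphisms into [C / a C] are represented by maps [g : R -> R] which are
    linear modulo [a C] on their domain. A homomorphism [m -> C / a C] is lifted on
    generators of [m]; the values of the lift on the syzygies are divisible by [a],
    and the quotients form a 2-cocycle, so that [Ext^2(R / m, C) = 0] corrects the
    lift into an honest homomorphism [m -> C]. As it maps [a] into [a C] and [a] is
    regular, it is a multiplication by an element of [C]. *)
Lemma hom_mod_lift a g : ext_length d K 2 0 -> GRing.lreg a -> m a ->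
    (forall x, m x -> C (g x)) ->
    (forall r x y, m x -> m y -> ideal_mul (principal a) C (g (r * x + y) - (r * g x + g y))) ->
    ideal_mul (principal a) C (g a) ->
  exists w, C w /\ forall x, m x -> ideal_mul (principal a) C (g x - x * w).
Proof.
move=> ext2 rega ma gC glin ga.
pose aC := ideal_mul (principal a) C.
have iaC : ideal aC by exact: ideal_ideal_mul.
have aCP x : aC x <-> exists c, C c /\ x = a * c by exact: ideal_mul_principalP.
have gsum (T : finType) (c : T -> R) (z : T -> R) : (forall k, m (z k)) ->
    aC (g (\sum_k c k * z k) - \sum_k c k * g (z k)).
  move=> mz.
  have g0 : aC (g 0).
    have := glin 0 _ _ (ideal0 (local_ideal Hloc)) (ideal0 (local_ideal Hloc)).
    rewrite mul0r addr0.
    have -> : g 0 - (0 * g 0 + g 0) = 0 by ring.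
    move=> _; have := glin 1 _ _ (ideal0 (local_ideal Hloc)) (ideal0 (local_ideal Hloc)).
    rewrite mulr0 addr0.
    have -> : g 0 - (1 * g 0 + g 0) = - g 0 by ring.
    by move=> /(idealN iaC); rewrite opprK.
  suff [] : m (\sum_k c k * z k) /\ aC (g (\sum_k c k * z k) - \sum_k c k * g (z k)) by [].
  apply: (big_rec2 (fun u v => m u /\ aC (g u - v))).
    by split; [exact: ideal0 (local_ideal Hloc) | rewrite subr0].
  move=> k u v _ [mv H]; split; first exact: idealL (local_ideal Hloc) (mz k) mv.
  have := idealD iaC (glin (c k) _ _ (mz k) mv) H; congr (aC _); ring.
have /choice[v vE] k : exists v : K, f v = g (gen k).
  exact: f_surj (gC _ (gen_m k)).
have /choice[u uE] j : exists u : K, f (\sum_k d 1%N j k *: v k) = a * f u.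
  have : aC (f (\sum_k d 1%N j k *: v k)).
    rewrite fS; under eq_bigr do rewrite vE.
    have H0 := gsum _ (d 1%N j) gen gen_m.
    have H1 := gsum _ (fun k => 0) gen gen_m.
    rewrite d1_gen in H0; rewrite big1 in H1; last by move=> k _; rewrite mul0r.
    rewrite [X in _ - X]big1 ?subr0 in H1; last by move=> k _; rewrite mul0r.
    by have := idealB iaC H1 H0; rewrite subKr.
  by move=> /aCP[c [/f_surj[w <-] E]]; exists w.
have cocu : @cocycles R n d K 2 [ffun j => u j].
  apply/ffunP => i; rewrite !ffunE; apply: f_inj; rewrite fS linear0.
  apply: rega; rewrite mulr0 mulr_sumr.
  under eq_bigr => j _ do rewrite ffunE mulrCA -uE fS mulr_sumr.
  rewrite exchange_big big1 //= => k _.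
  under eq_bigr do rewrite mulrA.
  rewrite -mulr_suml.
  by have /matrixP/(_ i k) := d_comp 1; rewrite !mxE => ->; rewrite mul0r.
have [u' _ u'E] : range (hom_dual (K := K) (d 1%N)) [ffun j => u j].
  by rewrite -[range _]/(@coboundaries R n d K 2) -(length0 ext2).
pose v' k := f (v k) - a * f (u' k).
have v'syz j : \sum_k d 1%N j k * v' k = 0.
  rewrite /v'; under eq_bigr do rewrite mulrBr mulrCA.
  rewrite sumrB -mulr_sumr -!fS uE; have /ffunP/(_ j) := u'E.
  by rewrite !ffunE => ->; rewrite subrr.
have [w aE] := (mE a).1 ma.
pose W := \sum_k w k * v' k.
have vW k : a * v' k = gen k * W.
  (* [a e_k - gen k * w] is a syzygy of the generators of [m], on which [v'] vanishes. *)
  pose y : 'rV[R]_(n 0%N) := \row_i (a * (i == k)%:R - gen k * w i).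
  have sumy (z : 'I_(n 0%N) -> R) :
      \sum_i y 0 i * z i = a * z k - gen k * \sum_i w i * z i.
    rewrite mulr_sumr [X in X - _](_ : _ = \sum_i a * (i == k)%:R * z i).
      by rewrite -sumrB; apply: eq_bigr => i _; rewrite mxE; ring.
    rewrite (bigD1 k) //= eqxx mulr1 big1 ?addr0 // => i /negPf->.
    by rewrite mulr0 mul0r.
  have : y *m d 0%N = 0.
    apply/matrixP => i j; rewrite !ord1 !mxE; apply: (etrans (sumy gen)).
    by rewrite -aE mulrC subrr.
  move=> /(proj2 Hres 0%N)[q yE].
  apply/eqP; rewrite -subr_eq0 -sumy yE.
  under eq_bigr do rewrite mxE mulr_suml.
  rewrite exchange_big big1 //= => j _.
  by under eq_bigr do rewrite -mulrA; rewrite -mulr_sumr v'syz mulr0.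
have /aCP[o [Co WE]] : aC W.
  have Wsub : aC (\sum_k w k * f (v k) - W).
    rewrite /W -sumrB; apply: ideal_sum => // k; apply/aCP; exists (w k * f (u' k)).
    by split; [apply: idealMl => //; exact: fCv | rewrite /v'; ring].
  have H := gsum _ w gen gen_m; rewrite -aE in H.
  have := idealB iaC (idealB iaC ga H) Wsub; congr (aC _).
  by under eq_bigr do rewrite -vE; ring.
have v'o k : v' k = gen k * o.
  by apply: rega; rewrite vW WE; ring.
exists o; split=> // x /mE[y xE].
have H := gsum _ y gen gen_m; rewrite -xE in H.
have H' : aC (\sum_k y k * g (gen k) - x * o).
  rewrite xE mulr_suml -sumrB; apply: ideal_sum => // k; apply/aCP.
  exists (y k * f (u' k)); split; first by apply: idealMl => //; exact: fCv.
  rewrite -mulrA -v'o -vE /v'; ring.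
by have := idealD iaC H H'; congr (aC _); ring.
Qed.

(** [Ext^1(R / m, C)] is the quotient of [Hom(m, C)] by the multiplications, so
    that its length being one makes any two classes proportional. *)
Lemma hom_proportional g h : ext_length d K 1 1 ->
    (forall x, m x -> C (g x)) -> (forall x, m x -> C (h x)) ->
    (forall r x y, m x -> m y -> g (r * x + y) = r * g x + g y) ->
    (forall r x y, m x -> m y -> h (r * x + y) = r * h x + h y) ->
    ~ (exists c, C c /\ forall x, m x -> g x = x * c) ->
  exists r c, C c /\ forall x, m x -> h x = r * g x + x * c.
Proof.
move=> ext1 gC hC glin hlin nmult.
have lsum k0 (T : finType) (c : T -> R) (z : T -> R) :
    (forall r x y, m x -> m y -> k0 (r * x + y) = r * k0 x + k0 y) ->
    (forall k, m (z k)) -> k0 (\sum_k c k * z k) = \sum_k c k * k0 (z k).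
  move=> klin mz; have m0 := ideal0 (local_ideal Hloc).
  have k00 : k0 0 = 0.
    have := klin 1 0 0 m0 m0; rewrite mulr0 addr0 mul1r => E.
    by apply: (addrI (k0 0)); rewrite -E addr0.
  suff [] : m (\sum_k c k * z k) /\ k0 (\sum_k c k * z k) = \sum_k c k * k0 (z k) by [].
  apply: (big_rec2 (fun u v => m u /\ k0 u = v)) => // k u v _ [mv <-].
  by split; [exact: idealL (local_ideal Hloc) (mz k) mv | rewrite klin].
pose cob := @coboundaries R n d K 1.
have [scob scoc] := chainable_submod (length_chainable ext1).
have cocycle k0 : (forall x, m x -> C (k0 x)) ->
    (forall r x y, m x -> m y -> k0 (r * x + y) = r * k0 x + k0 y) ->
    exists v : {ffun 'I_(n 0%N) -> K}, @cocycles R n d K 1 v /\ forall k, f (v k) = k0 (gen k).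
  move=> kC klin; have /choice[v vE] k : exists v : K, f v = k0 (gen k).
    exact: f_surj (kC _ (gen_m k)).
  exists [ffun k => v k]; split=> [|k]; last by rewrite ffunE.
  apply/ffunP => j; rewrite !ffunE; apply: f_inj; rewrite fS linear0.
  under eq_bigr do rewrite ffunE vE.
  rewrite -(lsum k0) // d1_gen; have := lsum k0 _ (fun=> 0) gen klin gen_m.
  by rewrite !big1 // => i _; rewrite mul0r.
have [v [vZ vE]] := cocycle g gC glin.
have [u [uZ uE]] := cocycle h hC hlin.
have cobE (b : {ffun 'I_(n 0%N) -> K}) : cob b ->
    exists c, C c /\ forall k, f (b k) = gen k * c.
  move=> [p _ <-]; exists (f (p ord0)); split; first exact: fCv.
  by move=> k; rewrite ffunE fS big_ord_recl big_ord0 addr0.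
have nvB : ~ cob v.
  move=> /cobE[c [Cc E]]; apply: nmult; exists c; split=> // x /mE[y xE].
  rewrite xE (lsum g) // mulr_suml; apply: eq_bigr => k _.
  by rewrite -vE E mulrA.
pose P := [set z : {ffun 'I_(n 0%N) -> K} | exists r b, cob b /\ z = r *: v + b].
have sP : submodule P.
  apply/submoduleP; split; first by exists 0, 0; rewrite scale0r addr0; split=> //; exact: submod0 scob.
  move=> r _ _ [r1 [b1 [B1 ->]]] [r2 [b2 [B2 ->]]].
  exists (r * r1 + r2), (r *: b1 + b2); split; first exact: (submodL r scob).
  by rewrite scalerDl scalerDr scalerA addrACA.
have PZ : P `<=` @cocycles R n d K 1.
  move=> _ [r [b [Bb ->]]]; apply: (submodL r scoc) => //.
  exact: (length_sub ext1).
have BP : cob `<=` P by move=> b Bb; exists 0, b; rewrite scale0r add0r.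
have Pv : P v by exists 1, 0; rewrite scale1r addr0; split=> //; exact: submod0 scob.
have [r [b [Bb uE']]] : P u.
  apply: contrapT => nPu.
  suff c2 : chainable cob (@cocycles R n d K 1) 2 by have := length_max ext1 c2.
  apply: (@chainable_rcons _ _ _ P) => //; last first.
    by split=> // ZP; apply: nPu; exact: ZP.
  apply: (@chainable_rcons _ _ _ cob) => //; first exact: chainable_nil.
  by split=> // PB; apply: nvB; exact: PB.
have [c [Cc bE]] := cobE b Bb.
exists r, c; split=> // x /mE[y xE]; rewrite xE (lsum h) // (lsum g) // mulr_suml mulr_sumr -big_split.
apply: eq_bigr => k _ /=.
by rewrite -uE uE' !ffunE linearD linearZ /= vE bE /GRing.scale /=; ring.
Qed.

End Resolution.

Section Regular.
Variable a : R.
Hypotheses (a_reg : GRing.lreg a) (Ca : C a)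
  (m_rad : m `<=` radical (ideal_mul (principal a) C)).

Let aC := ideal_mul (principal a) C.
Let iaC : ideal aC := ideal_ideal_mul _ _.

Let aC_sub_a : aC `<=` principal a.
Proof. by move=> x /(ideal_mul_principalP _ _ iC)[c [_ ->]]; apply/principalP; exists c; ring. Qed.

Lemma canonical_ideal_sub : C `<=` m.
Proof. exact: (proper_sub_local Hloc iC canonical_ideal_proper). Qed.

(** Baer's criterion for the injective hull [C / a C] of the residue field of
    [R / (a)], by descending induction on [I]. A homomorphism on [I] extends to
    [I + R z] when [z] is a socle element modulo [I]: for [r] in the maximal
    ideal the values [g (r z)] form a homomorphism [m -> C / a C] killing [a],
    which is a multiplication by some [w], and [w] serves as the value at
    [z]. *)
Lemma hom_mod_mult I g : ideal I -> I a ->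
    (forall x, I x -> C (g x)) ->
    (forall r x y, I x -> I y -> aC (g (r * x + y) - (r * g x + g y))) ->
    aC (g a) ->
  exists w, C w /\ forall x, I x -> aC (g x - x * w).
Proof.
move=> iI; move: I iI g; apply: (noetherian_ind (local_noetherian Hloc)).
move=> I iI IH g Ia gC glin ga.
have g0 : aC (g 0).
  have I0 := ideal0 iI; have := glin 1 0 0 I0 I0; rewrite mulr0 addr0.
  have -> : g 0 - (1 * g 0 + g 0) = - g 0 by ring.
  by move=> /(idealN iaC); rewrite opprK.
have gZ r x : I x -> aC (g (r * x) - r * g x).
  move=> Ix; have := idealD iaC (glin r x 0 Ix (ideal0 iI)) g0.
  by rewrite addr0; congr (aC _); ring.
have [I1|nI1] := pselect (I 1).
  exists (g 1); split; first exact: gC.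
  by move=> x _; rewrite -{1}[x]mulr1; exact: gZ.
have mI : m `<=` radical I.
  apply: subset_trans m_rad (radical_sub _) => x /aC_sub_a /principalP[r ->].
  exact: idealMl.
have [z' [nIz mz]] := socle_element Hloc iI mI nI1.
set z := z' * 1 in nIz mz.
have [K [f [n [d [f_inj fC res _ ext2]]]]] := canonical_ext.
have [w [Cw wE]] : exists w, C w /\ forall r, m r -> aC (g (r * z) - r * w).
  apply: (hom_mod_lift f_inj fC res (g := fun r => g (r * z))) => //.
  - exact: canonical_ideal_sub.
  - by move=> r mr; apply/gC/mz.
  - move=> r x y mx my; rewrite mulrDl -mulrA; apply: glin; exact: mz.
  - have := idealD iaC (gZ z a Ia) (idealMl z iaC ga).
    by rewrite subrK mulrC.
have indep i1 r1 i2 r2 : I i1 -> I i2 -> i1 + r1 * z = i2 + r2 * z ->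
    aC ((g i1 + r1 * w) - (g i2 + r2 * w)).
  move=> I1 I2 E.
  have i2E : i2 = 1 * ((r1 - r2) * z) + i1.
    by rewrite mul1r mulrBl addrAC [_ + i1]addrC E addrK.
  have Idz : I ((r1 - r2) * z).
    have -> : (r1 - r2) * z = i2 - i1 by rewrite i2E; ring.
    exact: idealB.
  have mr : m (r1 - r2).
    apply: contrapT => /(local_unit Hloc)[u uE]; apply: nIz.
    by rewrite -[z]mul1r -uE -mulrA; exact: idealMl.
  have := idealN iaC (idealD iaC (glin 1 _ _ Idz I1) (wE _ mr)).
  by rewrite -i2E; congr (aC _); ring.
have /choice[dec decE] x : exists ir : R * R,
    adjoin I z x -> I ir.1 /\ x = ir.1 + ir.2 * z.
  have [[i [r [Ii xE]]]|nx] := pselect (adjoin I z x); last by exists (0, 0).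
  by exists (i, r).
(* By [indep], this does not depend on the decompositions modulo [a C]. *)
pose g' x := g (dec x).1 + (dec x).2 * w.
have g'g x : I x -> aC (g' x - g x).
  move=> Ix; have [Id xE] := decE x (adjoin_sub z Ix).
  have := @indep (dec x).1 (dec x).2 x 0 Id Ix.
  by rewrite !mul0r !addr0 -xE => /(_ erefl).
have [o [Co oE]] : exists o, C o /\ forall x, adjoin I z x -> aC (g' x - x * o).
  apply: IH.
  - exact: ideal_adjoin.
  - exact: adjoin_proper.
  - exact: adjoin_sub.
  - move=> x /decE[Ix _]; apply: idealD => //; first exact: gC.
    exact: idealMl.
  - move=> r x y Ix Iy.
    have Ixy := idealL r (ideal_adjoin z iI) Ix Iy.
    have [Idx xE] := decE _ Ix; have [Idy yE] := decE _ Iy.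
    have [Idxy xyE] := decE _ Ixy.
    have H := @indep _ (dec (r * x + y)).2 (r * (dec x).1 + (dec y).1)
      (r * (dec x).2 + (dec y).2) Idxy (idealL r iI Idx Idy).
    have {}H := H _; rewrite -xyE in H.
    have {}H := H ltac:(rewrite {1}xE {1}yE; ring).
    have := idealD iaC H (glin r _ _ Idx Idy); rewrite /g'; congr (aC _); ring.
  - have := idealD iaC (g'g a Ia) ga; by rewrite subrK.
exists o; split=> // x Ix.
have := idealB iaC (oE x (adjoin_sub z Ix)) (g'g x Ix).
by congr (aC _); ring.
Qed.

(** The equality [C : C = R], in the form that [C / a C] is a faithful module
    over [R / (a)]. A nonzero element annihilating it may be taken in the socle
    of [R / (a)]; sending it to a socle element of [C / a C] then defines a
    homomorphism which is not a multiplication. *)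
Lemma canonical_faithful x : (forall c, C c -> aC (x * c)) -> principal a x.
Proof.
move=> xC; apply: contrapT => nax.
have ma : m a by exact: canonical_ideal_sub.
have m_rada : m `<=` radical (principal a) by apply: subset_trans m_rad (radical_sub _).
have aCP y : aC y <-> exists c, C c /\ y = a * c by exact: ideal_mul_principalP.
have naC : ~ aC a.
  move=> /aCP[c [Cc E]]; apply: canonical_ideal_proper.
  suff <- : c = 1 by [].
  by apply: a_reg; rewrite -E mulr1.
have [y [nay my]] := socle_element Hloc (ideal_principal a) m_rada nax.
have [y' [nas ms]] := socle_element Hloc iaC m_rad naC.
set z := y * x in nay my; set s := y' * a in nas ms.
have Cs : C s by exact: idealMl.
have zC c : C c -> aC (c * z).
  move=> Cc; have := idealMl y iaC (xC c Cc); congr (aC _); rewrite /z; ring.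
have zs r : principal a (r * z) -> aC (r * s).
  move=> arz; apply: ms; apply: contrapT => /(local_unit Hloc)[u uE]; apply: nay.
  by rewrite -[z]mul1r -uE -mulrA; exact: idealMl (ideal_principal a) arz.
pose I := adjoin (principal a) z.
have iI : ideal I by apply: ideal_adjoin; exact: ideal_principal.
have /choice[c cE] v : exists r, I v -> principal a (v - r * z).
  have [[i [r [ai vE]]]|nv] := pselect (I v); last by exists 0.
  by exists r => _; rewrite vE addrK.
pose g v := c v * s.
have aI : principal a `<=` I by exact: adjoin_sub.
have iPa := ideal_principal a.
have aa : principal a a by apply/principalP; exists 1; rewrite mul1r.
have [w [Cw wE]] : exists w, C w /\ forall v, I v -> aC (g v - v * w).
  apply: hom_mod_mult => //; first exact: aI.
  - by move=> v _; exact: idealMl.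
  - move=> r u v Iu Iv.
    have := zs (c (r * u + v) - (r * c u + c v)).
    rewrite /g => H; have {}H := H _.
    have -> : c (r * u + v) * s - (r * (c u * s) + c v * s) =
      (c (r * u + v) - (r * c u + c v)) * s by ring.
    apply: H.
    have := idealB iPa (idealL r iPa (cE u Iu) (cE v Iv)) (cE _ (idealL r iI Iu Iv)).
    by congr (principal a _); ring.
  - apply: zs; have := idealB iPa aa (cE a (aI _ aa)).
    by congr (principal a _); ring.
apply: nas.
have Iz : I z by exact: adjoin_mem.
have H1 := wE z Iz.
have H2 : aC ((1 - c z) * s) by apply: zs; rewrite mulrBl mul1r; exact: cE.
have H3 := zC w Cw.
have := idealD iaC (idealD iaC H1 H2) H3; congr (aC _); rewrite /g; ring.
Qed.

End Regular.

End CanonicalIdeal.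

(** * The filtration by powers of a reduction *)

Section Reduction.
Variables (R : comNzRingType) (m C : set R) (a : R).
Implicit Types (I J : set R) (x y r : R).

Lemma depth1_regular : depth m 1 -> exists x, m x /\ GRing.lreg x.
Proof.
move=> [[[|x [|]] // [xm reg] _] _]; exists x; split.
  by apply: xm; rewrite /= mem_head.
move=> u v E; apply/eqP; rewrite -subr_eq0; apply/eqP.
apply: (@span_nil R R^o); apply: (reg 0%N) => //=.
have -> : x * (u - v) = 0 by rewrite mulrBr E subrr.
exact: ideal0 (ideal_ideal_span _).
Qed.

Lemma lreg_radical x : radical (principal a) x -> GRing.lreg x -> GRing.lreg a.
Proof.
move=> [k /principalP[r xE]] xreg u v E.
by apply: (lregX (n := k) xreg); rewrite xE -!mulrA E.
Qed.

Lemma length_mul I J l : GRing.lreg a -> ideal I -> ideal J ->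
    ideal_length I J l ->
  ideal_length (ideal_mul (principal a) I) (ideal_mul (principal a) J) l.
Proof.
move=> areg iI iJ h.
have JI := length_sub h.
have P K x : ideal K -> ideal_mul (principal a) K x <-> exists c, K c /\ x = a * c.
  by move=> iK; exact: ideal_mul_principalP.
apply: (@length_iso R R^o R^o (fun x => a * x)) h.
- by move=> r x y; rewrite /GRing.scale /=; ring.
- exact: ideal_ideal_mul.
- exact: ideal_ideal_mul.
- move=> x /(P _ _ iJ)[c [Jc ->]]; apply/P => //.
  by exists c; split=> //; exact: JI.
- by move=> x Ix; apply/P => //; exists x.
- move=> y /(P _ _ iI)[c [Ic ->]]; exists c; split=> //.
  by rewrite subrr; exact: ideal0 (ideal_ideal_mul _ _).
move=> x Ix; split=> [Jx|/(P _ _ iJ)[c [Jc E]]]; first by apply/P => //; exists x.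
by rewrite (areg _ _ E).
Qed.

Lemma ideal_pow1 : ideal C -> ideal_pow C 1 = C.
Proof.
move=> iC; apply/seteqP; split=> x.
  by apply: ideal_mul_min => // u v Cu _; exact: idealMr.
by move=> Cx; rewrite -[x]mulr1; exact: ideal_mul_mem.
Qed.

Lemma ideal_pow_decr i j : (i <= j)%N -> ideal_pow C j `<=` ideal_pow C i.
Proof.
elim: j => [|j IH]; first by rewrite leqn0 => /eqP->.
rewrite leq_eqVlt => /orP[/eqP-> //|/IH]; apply: subset_trans => x.
apply: ideal_mul_min; first exact: ideal_ideal_pow.
by move=> u v _; apply: idealMl; exact: ideal_ideal_pow.
Qed.

Hypothesis Ca : C a.

Lemma mul_pow_sub j : ideal_mul (principal a) (ideal_pow C j) `<=` ideal_pow C j.+1.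
Proof.
move=> x /(ideal_mul_principalP _ _ (ideal_ideal_pow _ _))[c [Cc ->]].
exact: ideal_mul_mem.
Qed.

Lemma reduction_step j : ideal_pow C j.+1 = ideal_mul (principal a) (ideal_pow C j) ->
  ideal_pow C j.+2 = ideal_mul (principal a) (ideal_pow C j.+1).
Proof.
move=> E; apply/seteqP; split; last exact: mul_pow_sub.
move=> x; apply: (ideal_mul_min (ideal_ideal_mul _ _)) => u v Cu Cv.
have : ideal_mul (principal a) (ideal_pow C j) v by rewrite -E.
move=> /(ideal_mul_principalP _ _ (ideal_ideal_pow _ _))[c [Cc ->]].
apply/(ideal_mul_principalP _ _ (ideal_ideal_pow _ _)).
by exists (u * c); split; [exact: ideal_mul_mem | ring].
Qed.

Variable n0 : nat.
Hypothesis red : ideal_pow C n0.+1 = ideal_mul (principal a) (ideal_pow C n0).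

Lemma reduction_stable j : (n0 <= j)%N ->
  ideal_pow C j.+1 = ideal_mul (principal a) (ideal_pow C j).
Proof.
elim: j => [|j IH]; first by rewrite leqn0 => /eqP <-.
by rewrite leq_eqVlt => /orP[/eqP<- //|/IH]; exact: reduction_step.
Qed.

Lemma radical_mul_pow j :
  radical C `<=` radical (ideal_mul (principal a) (ideal_pow C j)).
Proof.
move=> x /(@radical_pow _ _ _ (maxn n0 j).+1).
apply: radical_sub; rewrite reduction_stable ?leq_maxl // => y.
move=> /(ideal_mul_principalP _ _ (ideal_ideal_pow _ _))[c [Cc ->]].
apply/(ideal_mul_principalP _ _ (ideal_ideal_pow _ _)).
by exists c; split=> //; apply: ideal_pow_decr Cc; exact: leq_maxr.
Qed.

(** If [a] were in [m C], the power [C^(n0+1)] would equal its product with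
    [m], hence vanish by Nakayama, although it contains the regular element
    [a^(n0+1)]. *)
Lemma reduction_notin_mul : noetherian_local m -> GRing.lreg a ->
  ~ ideal_mul m C a.
Proof.
move=> Hloc areg mCa.
have H x : ideal_pow C n0.+1 x -> x = 0.
  apply: (nakayama Hloc (ideal_ideal_pow _ _)) => y.
  rewrite {1}red => /(ideal_mul_principalP _ _ (ideal_ideal_pow _ _))[c [Cc ->]].
  pose N := [set z | ideal_mul m (ideal_pow C n0.+1) (z * c)].
  apply: (@ideal_mul_min _ m C N) mCa.
    apply/idealP; split; first by rewrite /N /= mul0r; exact: ideal0 (ideal_ideal_mul _ _).
    move=> r u v Nu Nv; rewrite /N /= mulrDl -mulrA.
    exact: idealL (ideal_ideal_mul _ _) Nu Nv.
  move=> u v mu Cv; rewrite /N /= -mulrA; apply: ideal_mul_mem => //.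
  exact: ideal_mul_mem.
have : ideal_pow C n0.+1 (a ^+ n0.+1).
  elim: (n0.+1) => [//|k IH]; rewrite exprS; exact: ideal_mul_mem.
move=> /H E; have /eqP := lregX (n := n0.+1) areg (etrans (mulr1 _) (etrans E (esym (mulr0 _)))).
by rewrite oner_eq0.
Qed.

(** From [n0] on, [C^(n+1) = a C^n], so that the length of [R / C^n] increases by
    the length of [R / (a)] at each step: this is [e_0], and subtracting the length
    of [R / C] leaves the length of [C / (a)]. *)
Lemma canonical_degree_length e :
    noetherian_local m -> GRing.lreg a -> ideal C -> radical C = m ->
    ideal_length C (principal a) e ->
  forall c, canonical_degree C c <-> c = e%:Z.
Proof.
move=> Hloc areg iC radC he c.
have pE : ideal_mul (principal a) [set: R] = principal a.
  apply/seteqP; split=> x.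
    move=> /(ideal_mul_principalP _ _ (@idealT R))[r [_ ->]].
    by apply/principalP; exists r; rewrite mulrC.
  move=> /principalP[r ->]; apply/(ideal_mul_principalP _ _ (@idealT R)).
  by exists r; rewrite mulrC.
have pow_rad j : m `<=` radical (ideal_pow C j).
  rewrite -radC => x [k Ck]; apply: radical_pow; by exists k.
have [l hl] : exists l, ideal_length [set: R] C l.
  by apply: (finite_length Hloc iC); rewrite radC.
have ha : ideal_length [set: R] (principal a) (l + e) by exact: length_add hl he.
have /choice[h hE] j : exists k, ideal_length [set: R] (ideal_pow C j) k.
  exact: (finite_length Hloc (ideal_ideal_pow _ _) (pow_rad j)).
have hS j : (n0 <= j)%N -> h j.+1 = (l + e + h j)%N.
  move=> nj; apply: length_uniq (hE j.+1) _; rewrite reduction_stable //.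
  apply: length_add ha _; rewrite -{1}pE.
  exact: length_mul (@idealT R) (ideal_ideal_pow _ _) (hE j).
split.
  move=> [e0 [e1 [l' [[N HN] hl' ->]]]].
  rewrite (length_uniq hl' hl).
  (* Two consecutive values of the Hilbert function determine [e0]. *)
  pose k := maxn N n0.
  have [k1 Hk1 E1] := HN k (leq_maxl _ _).
  have [k2 Hk2 E2] := HN k.+1 (leqW (leq_maxl _ _)).
  have := hS k.+1 (leqW (leq_maxr _ _)).
  rewrite (length_uniq (hE _) Hk1) (length_uniq (hE _) Hk2) => E.
  move: E2; rewrite E PoszD E1 !PoszD => E2.
  have -> : e0 = (l%:Z + e%:Z) by lia.
  lia.
move=> ->; exists (l + e)%N%:Z, (((l + e) * n0)%N%:Z - (h n0)%:Z), l.
split=> //; last by rewrite PoszD; ring.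
exists n0 => n nn; exists (h n.+1); first exact: hE.
have hk k : h (n0 + k)%N = ((l + e) * k + h n0)%N.
  elim: k => [|k IH]; first by rewrite muln0 addn0.
  by rewrite addnS hS ?leq_addr // IH mulnS addnA.
rewrite -{1}(subnKC (leqW nn)) hk.
rewrite PoszD !PoszM -subzn ?leqW //; ring.
Qed.

(** The quotient [C^(j+1) / a^j C] is filtered by the modules
    [a^(j-i) C^(i+1) / a^(j-i+1) C^i] for [1 <= i <= j]. *)
Lemma sally_length (d : nat -> nat) : GRing.lreg a -> ideal C ->
    (forall j, ideal_length (ideal_pow C j.+1)
       (ideal_mul (principal a) (ideal_pow C j)) (d j)) ->
  forall j, sally_component_length C a j (\sum_(1 <= i < j.+1) d i).
Proof.
move=> areg iC hd; elim=> [|j IH]; rewrite /sally_component_length.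
  rewrite big_geq // ideal_pow1 // expr0.
  have -> : ideal_mul (principal 1) C = C; last exact: length_refl.
  apply/seteqP; split=> x.
    by move=> /(ideal_mul_principalP _ _ iC)[c [Cc ->]]; rewrite mul1r.
  by move=> Cx; apply/(ideal_mul_principalP _ _ iC); exists x; rewrite mul1r.
rewrite big_nat_recr //= addnC; apply: length_add (hd j.+1) _.
have := length_mul areg (ideal_ideal_pow _ _) (ideal_ideal_mul _ _) IH.
congr ideal_length; apply/seteqP; split=> x.
  move=> /(ideal_mul_principalP _ _ (ideal_ideal_mul _ _))[c [H ->]].
  have [c' [Cc' ->]] := (ideal_mul_principalP _ _ iC).1 H.
  by apply/(ideal_mul_principalP _ _ iC); exists c'; rewrite exprS mulrA.
move=> /(ideal_mul_principalP _ _ iC)[c [Cc ->]].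
apply/(ideal_mul_principalP _ _ (ideal_ideal_mul _ _)); exists (a ^+ j * c).
split; last by rewrite exprS mulrA.
by apply/(ideal_mul_principalP _ _ iC); exists c.
Qed.

End Reduction.

(** * Canonical ideals with two generators *)

Section TwoGenerated.
Variables (R : comNzRingType) (m C : set R) (a b : R) (n0 : nat).
Hypotheses (Hloc : noetherian_local m) (Hdim : krull_dim R 1)
  (HC : canonical_ideal m C) (a_reg : GRing.lreg a) (Ca : C a) (Cb : C b)
  (CE : forall x, C x -> exists r s, x = r * a + s * b)
  (red : ideal_pow C n0.+1 = ideal_mul (principal a) (ideal_pow C n0)).
Implicit Types x y r s : R.

Let iC : ideal C := canonical_ideal_ideal HC.

Let aP j x : ideal_mul (principal a) (ideal_pow C j) x <->
  exists c, ideal_pow C j c /\ x = a * c.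
Proof. exact: ideal_mul_principalP (ideal_ideal_pow _ _). Qed.

Let iaP j : ideal (ideal_mul (principal a) (ideal_pow C j)) := ideal_ideal_mul _ _.

Lemma pow_gen j : ideal_pow C j (b ^+ j).
Proof. by elim: j => [//|j IH]; rewrite exprS; exact: ideal_mul_mem. Qed.

(** A monomial in the generators [a], [b] of degree [j + 1] other than [b^(j+1)]
    is divisible by [a], so that [b^(j+1)] generates [C^(j+1)] modulo [a C^j]. *)
Lemma powS_mod j x : ideal_pow C j.+1 x ->
  exists r, ideal_mul (principal a) (ideal_pow C j) (x - r * b ^+ j.+1).
Proof.
elim: j x => [|j IH] x.
  rewrite ideal_pow1 // => /CE[r [s ->]]; exists s.
  by apply/aP; exists r; split=> //; rewrite expr1; ring.
pose N := [set x | exists r, ideal_mul (principal a) (ideal_pow C j.+1) (x - r * b ^+ j.+2)].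
apply: (@ideal_mul_min _ _ _ N).
  apply/idealP; split; first by exists 0; rewrite mul0r subr0; exact: ideal0 (iaP _).
  move=> r u v [s1 H1] [s2 H2]; exists (r * s1 + s2).
  have := idealL r (iaP j.+1) H1 H2; congr (ideal_mul _ _ _); ring.
move=> u v /CE[r [s ->]] Cv.
have [t /aP[c [Cc E]]] := IH v Cv.
exists (s * t); apply/aP; exists (r * v + s * (b * c)); split.
  apply: (idealL r (ideal_ideal_pow C j.+1) Cv).
  by apply: (idealMl s (ideal_ideal_pow C j.+1)); exact: ideal_mul_mem.
have -> : v = a * c + t * b ^+ j.+1 by rewrite -E subrK.
by rewrite [b ^+ j.+2]exprS; ring.
Qed.

(** The cyclic module [C^(j+1) / a C^j], generated by the class of [b^(j+1)], is
    the quotient of [R] by this ideal. *)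
Definition step_ann j : set R :=
  [set r | ideal_mul (principal a) (ideal_pow C j) (r * b ^+ j.+1)].

Lemma step_annE j r :
  step_ann j r = ideal_mul (principal a) (ideal_pow C j) (r * b ^+ j.+1).
Proof. by []. Qed.

Lemma ideal_step_ann j : ideal (step_ann j).
Proof.
apply/idealP; split; first by rewrite step_annE mul0r; exact: ideal0 (iaP _).
move=> r x y Hx Hy; rewrite step_annE mulrDl -mulrA.
exact: idealL (iaP _) Hx Hy.
Qed.

Lemma step_ann_sub j : step_ann j `<=` step_ann j.+1.
Proof.
move=> r /aP[c [Cc E]]; apply/aP; exists (b * c); split; first exact: ideal_mul_mem.
by rewrite exprS mulrCA E; ring.
Qed.

(** If [r b^2] lies in [a C] then [r b] multiplies [C] into [a C], hence lies in
    [(a)] because [C : C = R]. *)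
Lemma step_ann01 : step_ann 0 = step_ann 1.
Proof.
apply/seteqP; split; first exact: step_ann_sub.
have C1 : ideal_pow C 1 = C by exact: ideal_pow1.
move=> r; rewrite (step_annE 1) C1 => H.
suff /principalP[s E] : principal a (r * b).
  by apply/aP; exists s; rewrite expr1 E mulrC.
apply: (canonical_faithful Hloc Hdim HC) => //.
  by rewrite -{1}C1 -(canonical_ideal_radical HC); exact: radical_mul_pow red _.
have iaC : ideal (ideal_mul (principal a) C) := ideal_ideal_mul _ _.
move=> c /CE[s [t ->]].
have -> : r * b * (s * a + t * b) = t * (r * b ^+ 2) + a * (s * (r * b)) by ring.
apply: (idealL t iaC) => //; apply/(ideal_mul_principalP _ _ iC).
by exists (s * (r * b)); split=> //; rewrite mulrA; exact: idealMl.
Qed.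

Lemma step_length_ann j l : ideal_length [set: R] (step_ann j) l ->
  ideal_length (ideal_pow C j.+1) (ideal_mul (principal a) (ideal_pow C j)) l.
Proof.
apply: (@length_iso R R^o R^o (fun r => r * b ^+ j.+1)).
- by move=> r x y; rewrite /GRing.scale /=; ring.
- exact: ideal_ideal_pow.
- exact: iaP.
- exact: mul_pow_sub.
- by move=> x _; have := idealMl x (ideal_ideal_pow C j.+1) (pow_gen j.+1).
- by move=> y /powS_mod[r H]; exists r.
- by [].
Qed.

Lemma step_lengths : exists d : nat -> nat, forall j,
  ideal_length [set: R] (step_ann j) (d j) /\
  ideal_length (ideal_pow C j.+1) (ideal_mul (principal a) (ideal_pow C j)) (d j).
Proof.
have /choice[d dE] j : exists l, ideal_length [set: R] (step_ann j) l.
  apply: (finite_length Hloc (ideal_step_ann j)).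
  rewrite -(canonical_ideal_radical HC).
  apply: subset_trans (radical_mul_pow Ca red j) (radical_sub _) => x.
  exact: idealMr (iaP j).
by exists d => j; split=> //; exact: step_length_ann.
Qed.

(** The almost Gorenstein case. When [step_ann 0] is the maximal ideal,
    [t x = x b / a] maps [m] to itself. The homomorphisms [x |-> t x * b] and
    [x |-> t (t x) * b] from [m] to [C] are multiplications by [b^2 / a] and
    [b^3 / a^2]; as [b^2] is not in [a C], the second is a multiple of the
    first modulo multiplications by elements of [C], which at [x = a] is a
    relation putting [b^3] in [a C^2]. *)
Lemma step_ann2_of_maximal : step_ann 0 = m -> step_ann 2 1.
Proof.
move=> E0; have E1 : step_ann 1 = m by rewrite -step_ann01.
have im := local_ideal Hloc.
have Cm : C `<=` m by exact: canonical_ideal_sub HC.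
have namC := reduction_notin_mul Ca red Hloc a_reg.
have C1 : ideal_pow C 1 = C by exact: ideal_pow1.
have /choice[t tE] x : exists y, m x -> m y /\ x * b = a * y.
  have [mx|nmx] := pselect (m x); last by exists 0.
  have : step_ann 0 x by rewrite E0.
  rewrite step_annE => /aP[y [_ xE]]; rewrite expr1 in xE.
  exists y => _; split=> //; apply: contrapT => /(local_unit Hloc)[u uE].
  apply: namC; have -> : a = x * (u * b).
    by rewrite mulrCA xE mulrCA uE mulr1.
  by apply: ideal_mul_mem => //; exact: idealMl.
have tm x : m x -> m (t x) by case/tE.
have xb x : m x -> x * b = a * t x by case/tE.
have tlin r x y : m x -> m y -> t (r * x + y) = r * t x + t y.
  move=> mx my; apply: a_reg; rewrite -xb; last exact: idealL.
  by rewrite mulrDr mulrCA -!xb //; ring.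
have ma := Cm a Ca.
have ta : t a = b by apply: a_reg; rewrite -xb.
have [K [f [n [d [f_inj fC res ext1 _]]]]] := canonical_ext Hdim HC.
have [r [c [Cc E]]] : exists r c, C c /\ forall x, m x ->
    t (t x) * b = r * (t x * b) + x * c.
  apply: (hom_proportional Hloc f_inj fC res (g := fun x => t x * b)
    (h := fun x => t (t x) * b) ext1).
  - by move=> x _; exact: idealMl.
  - by move=> x _; exact: idealMl.
  - by move=> r x y mx my; rewrite tlin //; ring.
  - by move=> r x y mx my; rewrite (tlin r x y) // (tlin r _ _ (tm _ mx) (tm _ my)); ring.
  move=> [c [Cc E]]; apply: (local_proper Hloc); rewrite -E1.
  rewrite step_annE C1; apply/(ideal_mul_principalP _ _ iC).
  by exists c; split=> //; rewrite mul1r -E // ta.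
have := E a ma; rewrite ta => Eb.
rewrite step_annE mul1r; apply/aP; exists (r * b ^+ 2 + a * c); split.
  apply: (idealL r (ideal_ideal_pow C 2) (pow_gen 2)).
  by apply: (@mul_pow_sub R C a Ca 1); apply/aP; exists c; rewrite C1.
have -> : b ^+ 3 = a * (t b * b) by rewrite mulrA -xb; [ring | exact: Cm].
by rewrite Eb; ring.
Qed.

End TwoGenerated.

(** Since [a] is a minimal generator of [C], it can replace one of two given
    generators. *)
Lemma two_generators (R : comNzRingType) (m C : set R) (a : R) :
    noetherian_local m -> ideal C -> cm_type C 2 -> C a -> ~ ideal_mul m C a ->
  exists b, C b /\ forall x, C x -> exists r s, x = r * a + s * b.
Proof.
move=> Hloc iC [[[|c1 [|c2 [|]]] // _ CE] _] Ca namC.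
have gen x : C x -> exists r s, x = r * c1 + s * c2.
  rewrite CE => /span_cons[r [y [/span_cons[s [z [/span_nil -> ->]]] ->]]].
  by exists r, s; rewrite addr0.
have C1 : C c1 by rewrite CE; apply: (@sub_span R R^o [set` _]); rewrite /= mem_head.
have C2 : C c2.
  by rewrite CE; apply: (@sub_span R R^o [set` _]); rewrite /= !in_cons eqxx orbT.
have [r [s aE]] := gen a Ca.
have [mr|/(local_unit Hloc)[u uE]] := pselect (m r); last first.
  exists c2; split=> // x /gen[p [q ->]]; exists (p * u), (q - p * u * s).
  rewrite aE -{1}[c1]mul1r -uE; ring.
have [ms|/(local_unit Hloc)[u uE]] := pselect (m s); last first.
  exists c1; split=> // x /gen[p [q ->]]; exists (q * u), (p - q * u * r).
  rewrite aE -{1}[c2]mul1r -uE; ring.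
case: namC; rewrite aE.
exact: (idealD (ideal_ideal_mul _ _) (ideal_mul_mem mr C1) (ideal_mul_mem ms C2)).
Qed.

(** The partitions of [3] in nonincreasing parts [d 1 >= d 2 >= ...] are [3],
    [2 + 1] and [1 + 1 + 1]; the last one is excluded by the almost Gorenstein
    case. *)
Lemma sum_step_eq3 (d : nat -> nat) :
    (forall j, (d j.+1 <= d j)%N) -> d 1%N = d 0%N -> (d 0%N = 1%N -> d 2%N = 0%N) ->
  (exists N, forall j, (N <= j)%N -> (\sum_(1 <= i < j.+1) d i)%N = 3%N) <->
  (d 0%N = 3%N /\ d 2%N = 0%N) \/ [/\ d 0%N = 2%N, d 2%N = 1%N & d 3%N = 0%N].
Proof.
move=> dS d1 d2.
have d0S i j : d i = 0%N -> (i <= j)%N -> d j = 0%N.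
  move=> di; elim: j => [|j IH]; first by rewrite leqn0 => /eqP E; rewrite -{1}E.
  rewrite leq_eqVlt => /orP[/eqP <- //|/IH dj].
  by have := dS j; rewrite dj leqn0 => /eqP.
have sumE j : (3 <= j)%N -> exists k, (\sum_(1 <= i < j.+1) d i = d 1 + d 2 + d 3 + k)%N /\
    (d 3 = 0 -> k = 0)%N.
  move=> j3; exists (\sum_(4 <= i < j.+1) d i)%N; split.
    by do 3 (rewrite big_ltn; last lia); rewrite !addnA.
  move=> d3; rewrite big_nat big1 // => i /andP[i4 _].
  by apply: d0S d3 _; lia.
split.
  move=> [N HN]; have [k [E Ek]] := sumE (maxn N 3) (leq_maxr _ _).
  rewrite HN ?leq_maxl // in E.
  have := dS 1%N; have := dS 2%N => dS2 dS1.
  have [[]|[? []]] : (d 0 = 3 /\ d 2 = 0 \/ d 0 = 2 /\ d 2 = 1 /\ d 3 = 0)%N by lia.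
    by left.
  by right.
move=> H; exists 3%N => j j3; have [k [-> Ek]] := sumE j j3.
have := dS 2%N; case: H => -[]; lia.
Qed.

Theorem proposition7p14 (R : comNzRingType) (m C : set R) (a : R) :
  cohen_macaulay_local m 1 ->
  canonical_ideal m C ->
  cm_type C 2 ->
  minimal_reduction (principal a) C ->
  almost_gorenstein C a 3 <->
    (canonical_degree C 3%:Z /\ reduction_number C a 2) \/
    [/\ canonical_degree C 2%:Z, reduction_number C a 3 &
        ideal_length (ideal_pow C 3)
          (ideal_mul (principal a) (ideal_pow C 2)) 1].
Proof.
move=> [Hloc Hdim Hdepth] HC Htype [[_ aC [n0 red]] _].
have iC := canonical_ideal_ideal HC; have radC := canonical_ideal_radical HC.
have Ca : C a by apply: aC; apply/principalP; exists 1; rewrite mul1r.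
have a_reg : GRing.lreg a.
  have [x [mx xreg]] := depth1_regular Hdepth; apply: lreg_radical xreg.
  move: mx; rewrite -radC => /(radical_mul_pow Ca red 0).
  apply: radical_sub => y /(ideal_mul_principalP _ _ (@idealT R))[c [_ ->]].
  by apply/principalP; exists c; rewrite mulrC.
have [b [Cb CE]] := two_generators Hloc iC Htype Ca (reduction_notin_mul Ca red Hloc a_reg).
have [d dE] := step_lengths Hloc HC Ca Cb CE red.
have dann j : ideal_length [set: R] (step_ann C a b j) (d j) by case: (dE j).
have dC j : ideal_length (ideal_pow C j.+1) (ideal_mul (principal a) (ideal_pow C j)) (d j).
  by case: (dE j).
have d0P j : d j = 0%N <-> ideal_pow C j.+1 = ideal_mul (principal a) (ideal_pow C j).
  split=> [dj|E]; first by have := dC j; rewrite dj => /(@length0 R R^o).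
  have := dC j; rewrite E => h.
  exact: length_uniq h (length_refl (ideal_ideal_mul _ _)).
have dS j : (d j.+1 <= d j)%N.
  have [l1 [l2 [h1 _ ->]]] := length_split (dann j) (ideal_step_ann C a b j.+1)
    (@step_ann_sub R C a b Cb j) (@subsetT _ _).
  by rewrite (length_uniq (dann j.+1) h1) leq_addr.
have d01 : d 1%N = d 0%N.
  apply: length_uniq (dann 1%N) _.
  by rewrite -(step_ann01 Hloc Hdim HC a_reg Ca Cb CE red); exact: dann.
have d2 : d 0%N = 1%N -> d 2%N = 0%N.
  move=> E; have h := dann 0%N; rewrite E in h.
  have E0 := length_one_eq_max Hloc (ideal_step_ann C a b 0) h.
  have := step_ann2_of_maximal Hloc Hdim HC a_reg Ca Cb CE red E0.
  move=> /(ideal1 (ideal_step_ann C a b 2)) E2.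
  have := dann 2%N; rewrite E2 => h2; exact: length_uniq h2 (length_refl (@idealT R)).
have degP c : canonical_degree C c <-> c = (d 0%N)%:Z.
  apply: (canonical_degree_length Ca red Hloc a_reg iC radC).
  have := dC 0%N; rewrite ideal_pow1 //; congr ideal_length.
  apply/seteqP; split=> x.
    move=> /(ideal_mul_principalP _ _ (@idealT R))[r [_ ->]].
    by apply/principalP; exists r; rewrite mulrC.
  move=> /principalP[r ->]; apply/(ideal_mul_principalP _ _ (@idealT R)).
  by exists r; rewrite mulrC.
have redP r : reduction_number C a r <-> d r = 0%N /\ forall s, (s < r)%N -> d s <> 0%N.
  split=> -[/d0P H1 H2]; split=> // s /H2 H; [move/d0P | move/d0P]; exact: H.
have AGP : almost_gorenstein C a 3 <->
    exists N, forall j, (N <= j)%N -> (\sum_(1 <= i < j.+1) d i)%N = 3%N.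
  have S := sally_length a_reg iC dC.
  split=> [[_ [N H]]|[N H]].
    by exists N => j /H; exact: length_uniq (S j).
  by split=> //; exists N => j /H <-; exact: S.
have dC2 : ideal_length (ideal_pow C 3) (ideal_mul (principal a) (ideal_pow C 2)) 1
    <-> d 2%N = 1%N.
  by split=> [/(length_uniq (dC 2%N))|E] //; have := dC 2%N; rewrite E.
split.
  move=> /AGP /(sum_step_eq3 dS d01 d2)[[E E2]|[E E2 E3]]; [left | right].
    split; first by apply/degP; rewrite E.
    by apply/redP; split=> // -[|[|//]] _; rewrite ?d01 E.
  split; [by apply/degP; rewrite E | | exact/dC2].
  by apply/redP; split=> // -[|[|[|//]]] _; rewrite ?d01 ?E2 ?E.
move=> H; apply/AGP/(sum_step_eq3 dS d01 d2).
case: H => [[/degP[E] /redP[E2 _]]|[/degP[E] /redP[E3 _] /dC2 E2]].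
  by left; split.
by right; split.
Qed.
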